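(* Given any lattice ideal $I_L$, where $L$ is a full rank sublattice of $A_n$ and any real number $\delta>0$, the Deformation Algorithm described below outputs a generic lattice ideal $I_{ L_{\rm{gen}}}$ such that $d(L_{\rm gen},L) \leq \delta$.
   Context: Let $K$ be an arbitrary field and $K[x_0,\dots,x_n]$ the polynomial ring. For a lattice $L\subseteq\mathbb{Z}^{n+1}$, the lattice ideal is $I_L=\langle \mathbf{x}^{\mathbf u}-\mathbf{x}^{\mathbf v} : \mathbf u-\mathbf v\in L,\ \mathbf u,\mathbf v\in\mathbb{N}^{n+1}\rangle$; it is generic if it is generated by binomials $\mathbf{x}^{\mathbf u}-\mathbf{x}^{\mathbf v}$ with $\mathbf u-\mathbf v$ of full support. $A_n=\{(x_0,\dots,x_n)\in\mathbb{Z}^{n+1}:\sum_j x_j=0\}$. The distance $d(L_1,L_2)$ between lattices is the minimum of $\|B_1-B_2\|_2$ over bases $B_1,B_2$ of $L_1,L_2$ written as matrices. For a directed graph with adjacency matrix $A$ and out-degree diagonal matrix $\mathcal D$, the Laplacian is $Q=\mathcal D-A$. Deformation Algorithm (input: $I_L$, $L$ full rank in $A_n$, and $\delta>0$): first compute (via Perkinson–Perlman–Wilmes) a strongly connected directed graph whose Laplacian $Q$ has rows generating $L$ and positive primitive left kernel vector $\mathbf\Sigma$ with $\Sigma_0=1$. Set $Q_0=Q$. At step $r$, let $\lambda_r$ be the least positive rational with $\lambda_rQ_r$ integral, and consider the Gröbner basis $\{\mathbf x^{\mathbf u^+}-\mathbf x^{\mathbf u^-}: \mathbf u=(\lambda_rQ_r)^T\mathbf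 x,\ \mathbf 0\le\mathbf x\le\mathbf\Sigma\}$ (a grevlex Gröbner basis for any linear extension of a rooted spanning tree order with root $v_0$). If all its exponent vectors have full support, output it, with $Q_{\rm gen}=Q_r$, $\lambda=\lambda_r$, $L_{\rm gen}$ the row lattice of $Q_{\rm gen}$. Otherwise there are $\mathbf 0\lneq\mathbf x\lneq\mathbf\Sigma$ and $i$ with $((\lambda_rQ_r)^T\mathbf x)_i=0$; choose $j$ with $x_j/\Sigma_j\ne x_i/\Sigma_i$; let $\hat Q_r$ be the Laplacian of the graph on $v_0,\dots,v_n$ with an edge $v_i\to v_j$ of weight $1/\Sigma_i$ and an edge $v_j\to v_i$ of weight $1/\Sigma_j$; set $Q_{r+1}=Q_r+\epsilon_r\hat Q_r$ with rational $\epsilon_r\ge0$ satisfying $\epsilon_r < -\min_{\{0\le y\le\mathbf\Sigma,\ (\hat Q_r^Ty)_k(Q_r^Ty)_k<0,\ k\in\{i,j\}\}}\{ (Q_r^Ty)_k/(\hat Q_r^Ty)_k,\ \delta/(|\hat Q_r|_1(n+1)\prod_s\Sigma_s)\}$, and repeat.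
   Formalization: The bound is read as ε_r below each |(Q_r^T y)_k/(Q̂_r^T y)_k| and below the δ-term, since the printed −min is garbled; as ε_r=0 may stall forever, ''outputs'' means a step with ε_r>0 is available until output and no run has infinitely many such steps. *)

(* Defs.v *)
From mathcomp Require Import all_boot all_order all_algebra.
From mathcomp Require Import boolp classical_sets reals.
From mathcomp Require Import mpoly.

Set Implicit Arguments.
Unset Strict Implicit.
Unset Printing Implicit Defensive.

Import Order.TTheory GRing.Theory Num.Theory.

Local Open Scope classical_set_scope.
Local Open Scope ring_scope.

Section Lattices.
Variable n : nat.

Definition full_rank_sublattice_An (L : set 'rV[int]_n.+1) : Prop :=
  [/\ L 0 /\ (forall u v, L u -> L v -> L (u - v)),
      (forall u, L u -> \sum_j u 0 j = 0)
    & exists B : 'M[int]_(n, n.+1),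
        (forall i, L (row i B)) /\ row_free (map_mx (intr : int -> rat) B)].

Definition row_lattice (F : fieldType) m k (B : 'M[F]_(m, k)) : set 'rV[F]_k :=
  [set v | exists c : 'rV[int]_m, v = map_mx intr c *m B].

Definition is_lattice_basis (F : fieldType) m k (L : set 'rV[F]_k)
    (B : 'M[F]_(m, k)) : Prop :=
  row_free B /\ row_lattice B = L.

Definition l2norm (R : realType) k (v : 'rV[R]_k) : R :=
  Num.sqrt (\sum_j v 0 j ^+ 2).

(* The matrix norm ||B||_2 induced by the Euclidean norm (spectral norm);
   v *m B ranges over the images of the unit ball under B^T, and B and B^T
   have the same spectral norm. *)
Definition mxnorm2 (R : realType) m k (B : 'M[R]_(m, k)) : R :=
  sup [set l2norm (v *m B) | v in [set v : 'rV[R]_m | l2norm v <= 1]].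

(* [d] is the distance of two rank [n] lattices of R^(n+1): it is the minimum,
   which is required to be attained. *)
Definition is_lattice_dist (R : realType) (L1 L2 : set 'rV[R]_n.+1) (d : R) :
    Prop :=
  (exists B1 B2 : 'M[R]_(n, n.+1),
     [/\ is_lattice_basis L1 B1, is_lattice_basis L2 B2
       & d = mxnorm2 (B1 - B2)]) /\
  (forall B1 B2 : 'M[R]_(n, n.+1),
     is_lattice_basis L1 B1 -> is_lattice_basis L2 B2 ->
     d <= mxnorm2 (B1 - B2)).

(* The lattice [c L], for [c L] contained in Z^(n+1). *)
Definition integral_multiple (c : rat) (L : set 'rV[rat]_n.+1) :
    set 'rV[int]_n.+1 :=
  [set w | exists2 v, L v & map_mx intr w = c *: v].

End Lattices.

Section LatticeIdeals.
Variables (K : fieldType) (n : nat).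

Definition ideal_gen (A : comNzRingType) (S : set A) : set A :=
  [set p | exists k (a g : 'I_k -> A),
     (forall i, S (g i)) /\ p = \sum_i a i * g i].

Definition exp_diff (u v : 'X_{1..n.+1}) : 'rV[int]_n.+1 :=
  \row_i ((u i)%:Z - (v i)%:Z).

Definition lattice_ideal (L : set 'rV[int]_n.+1) : set {mpoly K[n.+1]} :=
  ideal_gen [set p | exists u v : 'X_{1..n.+1},
                       L (exp_diff u v) /\ p = 'X_[u] - 'X_[v]].

Definition full_support (F : pzRingType) k (u : 'rV[F]_k) : Prop :=
  forall i, u 0 i != 0.

Definition generic_lattice_ideal (L : set 'rV[int]_n.+1) : Prop :=
  exists S : set ('X_{1..n.+1} * 'X_{1..n.+1}),
    (forall m, S m -> full_support (exp_diff m.1 m.2)) /\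
    lattice_ideal L = ideal_gen [set 'X_[m.1] - 'X_[m.2] | m in S].

Definition pos_part (u : 'rV[int]_n.+1) : 'X_{1..n.+1} :=
  [multinom `|Num.max (u 0%R i) 0%R|%N | i < n.+1].

Definition binomial_of (u : 'rV[int]_n.+1) : {mpoly K[n.+1]} :=
  'X_[pos_part u] - 'X_[pos_part (- u)].

End LatticeIdeals.

Arguments lattice_ideal K {n} L.
Arguments generic_lattice_ideal K {n} L.
Arguments binomial_of K {n} u.

Section DeformationAlgorithm.
Variable n : nat.
Implicit Types (Sigma x y : 'rV[nat]_n.+1) (Q : 'M[rat]_n.+1).

Definition laplacian (A : 'M[rat]_n.+1) : 'M[rat]_n.+1 :=
  diag_mx (\row_i \sum_j A i j) - A.

Definition strongly_connected (A : 'M[nat]_n.+1) : Prop :=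
  forall i j, connect [rel a b | A a b != 0%N] i j.

Definition natr_row x : 'rV[rat]_n.+1 := map_mx (fun k : nat => k%:R) x.

(* The result of the first step: [Q] is the Laplacian of a strongly connected
   directed (multi)graph, its rows generate [L], and [Sigma] spans its left
   kernel. *)
Definition initial_data (L : set 'rV[int]_n.+1) Sigma Q : Prop :=
  [/\ exists A : 'M[nat]_n.+1,
        strongly_connected A /\
        Q = laplacian (map_mx (fun k : nat => k%:R) A),
      row_lattice Q = [set map_mx intr v | v in L],
      natr_row Sigma *m Q = 0,
      (forall i, (0 < Sigma 0%R i)%N) /\ \big[gcdn/0%N]_i Sigma 0 i = 1%N
    & Sigma 0 0 = 1%N].

Definition integral_mx Q : Prop := forall i j, Q i j \is a Num.int.

(* The least positive rational [c] with [c Q] integral; the default value 1 is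
   only reached for [Q = 0], where there is no least one (this needs [n = 0]). *)
Definition scaling Q : rat :=
  xget 1 [set c : rat | [/\ 0 < c, integral_mx (c *: Q)
            & forall c', 0 < c' -> integral_mx (c' *: Q) -> c <= c']].

(* Column vectors are transposed: this is [Q^T x]. *)
Definition trmul Q x : 'rV[rat]_n.+1 := natr_row x *m Q.

Definition box Sigma : set 'rV[nat]_n.+1 :=
  [set x | forall i, (x 0%R i <= Sigma 0%R i)%N].

Definition open_box Sigma : set 'rV[nat]_n.+1 :=
  [set x | [/\ box Sigma x, x <> 0 & x <> Sigma]].

Definition groebner_set (K : fieldType) Sigma Q : set {mpoly K[n.+1]} :=
  [set binomial_of K u | u in
     [set u | exists2 x, box Sigma x &
                map_mx intr u = trmul (scaling Q *: Q) x]].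

(* Stopping test. The exponent vectors of [x = 0] and [x = Sigma] vanish, they
   correspond to the zero binomial and are disregarded. *)
Definition stops Sigma Q : Prop :=
  forall x, open_box Sigma x -> full_support (trmul (scaling Q *: Q) x).

(* The Laplacian of the two edges [v_i -> v_j] and [v_j -> v_i] with respective
   weights [1 / Sigma_i] and [1 / Sigma_j]. *)
Definition two_edges Sigma (i j : 'I_n.+1) : 'M[rat]_n.+1 :=
  laplacian (\matrix_(a, b)
    (if (a == i) && (b == j) then (Sigma 0 i)%:R^-1
     else if (a == j) && (b == i) then (Sigma 0 j)%:R^-1
     else 0)).

(* The matrix norm induced by the 1-norm, i.e. the maximal absolute column sum. *)
Definition mxnorm1 Q : rat := \big[Num.max/0]_j \sum_i `|Q i j|.

(* [eps] is less than the minimum of the absolute values of all the negative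
   quotients [(Q^T y)_k / (Qhat^T y)_k] and of the bound depending on [delta]. *)
Definition eps_admissible (R : realType) (delta : R) Sigma Q Qhat
    (i j : 'I_n.+1) (eps : rat) : Prop :=
  (forall y k, box Sigma y -> k \in [:: i; j] ->
     trmul Qhat y 0 k * trmul Q y 0 k < 0 ->
     eps < - (trmul Q y 0 k / trmul Qhat y 0 k)) /\
  ratr eps < delta /
    (ratr (mxnorm1 Qhat) * n.+1%:R * (\prod_s Sigma 0%R s)%:R).

Definition deform_step (R : realType) (delta : R) Sigma Q (eps : rat) Q' :
    Prop :=
  exists x i j,
    [/\ open_box Sigma x, trmul (scaling Q *: Q) x 0 i = 0,
        (x 0 j)%:R / (Sigma 0 j)%:R != (x 0 i)%:R / (Sigma 0 i)%:R :> rat,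
        0 <= eps /\ eps_admissible delta Sigma Q (two_edges Sigma i j) i j eps
      & Q' = Q + eps *: two_edges Sigma i j].

Inductive deform_reach (R : realType) (delta : R) Sigma Q :
    'M[rat]_n.+1 -> Prop :=
| deform_reach0 : deform_reach delta Sigma Q Q
| deform_reachS Q' eps Q'' :
    deform_reach delta Sigma Q Q' -> deform_step delta Sigma Q' eps Q'' ->
    deform_reach delta Sigma Q Q''.

(* The run starting from [Q] cannot get stuck: a reached matrix that is not
   output admits a step with positive parameter. *)
Definition deform_progress (R : realType) (delta : R) Sigma Q : Prop :=
  forall Q', deform_reach delta Sigma Q Q' -> ~ stops Sigma Q' ->
    exists eps Q'', 0 < eps /\ deform_step delta Sigma Q' eps Q''.

(* No run has infinitely many steps [eps > 0]. Since [eps = 0] leaves the matrix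
   unchanged, termination cannot be asked of runs that stall forever. *)
Definition deform_terminates (R : realType) (delta : R) Sigma Q : Prop :=
  forall (Qs : nat -> 'M[rat]_n.+1) (eps : nat -> rat),
    Qs 0%N = Q ->
    (forall r, deform_step delta Sigma (Qs r) (eps r) (Qs r.+1)) ->
    exists N, forall r, (N <= r)%N -> eps r = 0.

End DeformationAlgorithm.

Arguments groebner_set {n} K Sigma Q.

(* Main.v *)
(* An admissible step keeps every nonzero (Q^T y)_k with y in the box nonzero,
   and a step with eps > 0 along the edge {i, j} makes (Q^T y)_i nonzero for all
   y in the box with y_i / Sigma_i <> y_j / Sigma_j.  Hence every pair {i, j} is
   used at most once with a positive parameter, which bounds the number of
   such steps, and the total perturbation is the Laplacian of the weights
   e_ij / Sigma_i for a symmetric e whose entries are controlled by delta; its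
   row and column sums bound the spectral norm (Schur test).  The box binomials
   generate the lattice ideal by chip firing.

   For the initial Laplacian, order the vertices as 0, ..., n and take for each
   k < n a vector of L supported on {k, ..., n} whose k-th entry is negative
   and minimal in absolute value.  Since L contains D * A_n for some D > 0, the
   entries beyond k + 1 can be made nonpositive at the expense of the entry
   k + 1.  These n vectors form a basis of L, and D * (e_1 + ... + e_n - n e_0)
   is a positive combination of them. *)
Require Import Defs.
From mathcomp Require Import all_boot all_order all_algebra.
From mathcomp Require Import boolp classical_sets reals.
From mathcomp Require Import mpoly.
From mathcomp Require Import zify ring lra.
Set Implicit Arguments.
Unset Strict Implicit.
Unset Printing Implicit Defensive.
Import Order.TTheory GRing.Theory Num.Theory.
Local Open Scope classical_set_scope.
Local Open Scope ring_scope.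

(** * The initial Laplacian *)

(** The common denominator is the product of all denominators; each entry of [N] is a numerator
    times the remaining factors. *)
Lemma clear_denominators m k (M : 'M[rat]_(m, k)) :
  exists (d : nat) (N : 'M[int]_(m, k)),
    (0 < d)%N /\ d%:R *: M = map_mx intr N.
Proof.
pose q i j : int := denq (M i j).
have qP i j : 0 < q i j by rewrite /q denq_gt0.
pose d : int := \prod_i \prod_j q i j.
have d0 : 0 < d by apply: prodr_gt0 => i _; apply: prodr_gt0.
exists `|d|%N; exists (\matrix_(i, j) (numq (M i j) *
  (\prod_(i' | i' != i) \prod_j' q i' j' * \prod_(j' | j' != j) q i j'))).
split; first by rewrite absz_gt0 gt_eqF.
apply/matrixP => i j; rewrite !mxE.
have -> : `|d|%N%:R = d%:~R :> rat by rewrite -[in RHS](gtz0_abs d0).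
have -> : d = q i j * (\prod_(i' | i' != i) \prod_j' q i' j' *
                       \prod_(j' | j' != j) q i j').
  rewrite /d (bigD1 i) //= (bigD1 j) //=; ring.

rewrite !intrM -[in LHS](divq_num_den (M i j)) /q.
have : (denq (M i j))%:~R != 0 :> rat by rewrite intr_eq0 denq_neq0.
by move=> h; rewrite [LHS]mulrC [LHS]mulrA divfK. 
Qed.

Lemma map_intr_inj k :
  injective (map_mx (intr : int -> rat) : 'rV_k -> 'rV_k).
Proof.
by move=> u v /rowP uv; apply/rowP => c; have := uv c; rewrite !mxE => /intr_inj.
Qed.

Section Laplacian.
Variables (n : nat) (A : 'M[rat]_n.+1).

Lemma laplacianE i j :
  laplacian A i j = (if i == j then \sum_k A i k else 0) - A i j.
Proof. by rewrite /laplacian !mxE; case: eqVneq. Qed.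

Lemma laplacian_sum i : \sum_j laplacian A i j = 0.
Proof.
under eq_bigr do rewrite laplacianE.
by rewrite sumrB -big_mkcond (big_pred1 i) ?subrr // => j; rewrite eq_sym.
Qed.

(** A loop weight [A i i] enters the degree and is subtracted again, so zero row sums and the
    off-diagonal entries determine a Laplacian. *)
Lemma laplacian_eq (Q : 'M[rat]_n.+1) :
  (forall i, \sum_j Q i j = 0) -> (forall i j, i != j -> A i j = - Q i j) ->
  laplacian A = Q.
Proof.
move=> Q0 AQ; apply/matrixP => i j; rewrite laplacianE.
case: eqVneq => [<-|ij]; last by rewrite AQ // sub0r opprK.
have := Q0 i; rewrite (bigD1 i) //= => /eqP; rewrite addr_eq0 => /eqP ->.
rewrite [X in X - _](bigD1 i) //= [LHS]addrC addKr -sumrN; apply: eq_bigr => k ki.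
by rewrite AQ // eq_sym.
Qed.

End Laplacian.

Section Sublattice.
Variables (n : nat) (L : set 'rV[int]_n.+1).
Hypothesis L0 : L 0.
Hypothesis LB : forall u v, L u -> L v -> L (u - v).

Lemma lattice_opp u : L u -> L (- u).
Proof. by move=> Lu; rewrite -sub0r; apply: LB. Qed.

Lemma lattice_add u v : L u -> L v -> L (u + v).
Proof. by move=> Lu Lv; rewrite -[v]opprK; apply: LB => //; apply: lattice_opp. Qed.

Lemma lattice_scale (c : int) u : L u -> L (c *: u).
Proof.
move=> Lu; have Lnat (k : nat) : L (k%:Z *: u).
  elim: k => [|k IH]; first by rewrite scale0r.
  by rewrite intS scalerDl scale1r; apply: lattice_add.
case: c => [k|k]; first exact: Lnat.
by rewrite NegzE scaleNr; apply/lattice_opp/Lnat.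
Qed.

Lemma lattice_sum (I : finType) (P : pred I) (F : I -> 'rV[int]_n.+1) :
  (forall i, P i -> L (F i)) -> L (\sum_(i | P i) F i).
Proof. by move=> LF; apply: (big_ind L) => //; apply: lattice_add. Qed.

End Sublattice.

Section InitialData.
Variables (n : nat) (L : set 'rV[int]_n.+1).
Hypothesis hL : full_rank_sublattice_An L.

Let e (i : 'I_n.+1) : 'rV[int]_n.+1 := delta_mx 0 i.

(** By dimension, the [n] independent rows of [B] span over the rationals the hyperplane of zero
    coordinate sum. So each [e i - e ord0], row [i] of [P], is a rational combination of them, and
    [D] clears the denominators. *)
Lemma multiple_of_An_in_lattice :
  exists2 D : nat, (0 < D)%N & forall i j, L (D%:Z *: (e i - e j)).
Proof.
case: hL => [[L0 LB] Lsum [B [LBr Bfree]]].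
pose Bq : 'M[rat]_(n, n.+1) := map_mx intr B.
pose ones : 'cV[rat]_n.+1 := const_mx 1.
pose P : 'M[rat]_n.+1 := \matrix_(i, j) ((i == j)%:R - (j == ord0)%:R).
have Pker : P *m ones = 0.
  apply/matrixP => i k; rewrite !mxE.
  under eq_bigr do rewrite !mxE mulr1.
  rewrite sumrB (bigD1 i) //= eqxx big1 ?addr0; last first.
    by move=> j /negPf; rewrite eq_sym => ->.
  rewrite (bigD1 ord0) //= big1 ?addr0 ?subrr //.
  by move=> j /negPf ->.
have Bker : Bq *m ones = 0.
  apply/matrixP => i k; rewrite !mxE.
  have Bsum : \sum_j B i j = 0.
    by rewrite -[RHS](Lsum _ (LBr i)); apply: eq_bigr => j _; rewrite mxE.
  rewrite -[RHS]/((0 : int)%:~R) -Bsum rmorph_sum.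
  by apply: eq_bigr => j _; rewrite !mxE mulr1.
have rk1 : \rank ones = 1%N.
  apply/eqP; rewrite eqn_leq rank_leq_col lt0n mxrank_eq0.
  by apply/eqP => /matrixP /(_ ord0 ord0) /eqP; rewrite !mxE oner_eq0.
have PB : (P <= Bq)%MS.
  apply: (@submx_trans _ _ _ _ _ _ (kermx ones)); first exact/sub_kermxP.
  have BK : (Bq <= kermx ones)%MS by exact/sub_kermxP.
  have := mxrank_leqif_eq BK => -[_ /esym].
  rewrite mxrank_ker rk1 subn1 /= (eqP Bfree) eqxx => /andP[_ ->//].
have [D [N [D0 DN]]] := clear_denominators (P *m pinvmx Bq).
exists D => // i j.
suff L1 k : L (D%:Z *: (e k - e ord0)).
  have -> : D%:Z *: (e i - e j) =
      D%:Z *: (e i - e ord0) - D%:Z *: (e j - e ord0).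
    by rewrite -scalerBr opprB addrA subrK.
  exact: LB.
suff -> : D%:Z *: (e k - e ord0) = \sum_l N k l *: row l B.
  by apply: lattice_sum => // l _; apply: lattice_scale => //; apply: LBr.
suff H : row k N *m B = D%:Z *: (e k - e ord0).
  rewrite -H; apply/rowP => c; rewrite !mxE summxE.
  by apply: eq_bigr => l _; rewrite !mxE.
apply: map_intr_inj.
rewrite map_mxM /= map_row -DN linearZ /= -scalemxAl -row_mul mulmxKpV //.
apply/rowP => c; rewrite !mxE eqxx /= intrM intrB eq_sym.
by case: (c == k); case: (c == ord0).
Qed.

(* Row [hi k] of the Laplacian to be built leaves to [lo k], its predecessor,
   and to vertices beyond [hi k]. *)
Let lo (k : 'I_n) : 'I_n.+1 := widen_ord (leqnSn n) k.
Let hi (k : 'I_n) : 'I_n.+1 := lift ord0 k.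

(** The sign conditions are those of a Laplacian row with diagonal position [hi k]; the divisibility
    makes the entry at [lo k] a pivot for integral elimination. *)
Lemma hessenberg_row (k : 'I_n) : exists r : 'rV[int]_n.+1,
  [/\ L r, r 0 (lo k) < 0, forall j : 'I_n.+1, (j < k)%N -> r 0 j = 0,
      forall j, j != hi k -> r 0 j <= 0
    & forall v, L v -> (forall j : 'I_n.+1, (j < k)%N -> v 0 j = 0) ->
        (r 0%R (lo k) %| v 0%R (lo k))%Z].
Proof.
have [D D0 LD] := multiple_of_An_in_lattice.
have [[L0 LB] _ _] := hL.
(* The index [t] stands for the entry [- (t + 1)], so that minimising over the naturals keeps the
   pivot negative. *)
pose P t := `[< exists v, [/\ L v, forall j : 'I_n.+1, (j < k)%N -> v 0 j = 0
                  & v 0 (lo k) = - (t.+1)%:Z] >].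
have hlo : hi k != lo k by rewrite -val_eqE /= /bump /=; lia.
have exP : exists t, P t.
  exists D.-1; apply/asboolP; exists (D%:Z *: (e (hi k) - e (lo k))); split.
  - exact: LD.
  - move=> j jk; rewrite !mxE !eqxx /=.
    have -> : j == hi k = false by rewrite -val_eqE /= /bump /=; lia.
    have -> : j == lo k = false by rewrite -val_eqE /=; lia.
    by rewrite subrr mulr0.
  - by rewrite !mxE !eqxx /= eq_sym (negPf hlo) prednK // sub0r mulrN mulr1.
case: (ex_minnP exP) => m /asboolP [v [Lv vlt vlo]] mmin.
pose N := (\sum_j `|v 0%R j|)%N.
have vN j : v 0 j <= N%:Z.
  apply: (@le_trans _ _ `|v 0%R j|%N%:Z); first by rewrite abszE ler_norm.
  by rewrite lez_nat /N (bigD1 j) //= leq_addr.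
(* Each summand leaves the entries up to [k] alone and lowers entry [j] by [N * D], hence by at
   least [v 0 j]; only the entry at [hi k] grows. *)
pose r := v + \sum_(j : 'I_n.+1 | (k.+1 < j)%N) N%:Z *: (D%:Z *: (e (hi k) - e j)).
have rE c : r 0 c = v 0 c + \sum_(j : 'I_n.+1 | (k.+1 < j)%N)
    N%:Z * (D%:Z * ((c == hi k)%:R - (c == j)%:R)).
  rewrite /r mxE summxE; congr (_ + _); apply: eq_bigr => j _.
  by rewrite !mxE !eqxx.
have rle (c : 'I_n.+1) : (c <= k)%N -> r 0 c = v 0 c.
  move=> ck; rewrite rE big1 ?addr0 // => j kj.
  have -> : c == hi k = false by rewrite -val_eqE /= /bump /=; lia.
  have -> : c == j = false by rewrite -val_eqE /=; lia.
  by rewrite subrr !mulr0.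
exists r; split.
- apply: lattice_add => //; apply: lattice_sum => // j _.
  by apply: lattice_scale.
- by rewrite rle // vlo; lia.
- by move=> j jk; rewrite rle ?vlt //; lia.
- move=> j jh; case: (ltngtP j k) => jk.
  + by rewrite rle ?vlt //; lia.
  + have kj : (k.+1 < j)%N by move: jh; rewrite -val_eqE /= /bump /=; lia.
    rewrite rE (bigD1 j) //= (negPf jh) eqxx big1 => [|c /andP[_ cj]].
      rewrite addr0 /= mulr0n mulr1n sub0r mulrN1 mulrN subr_le0.
      rewrite (le_trans (vN j)) //.
      by rewrite -PoszM lez_nat leq_pmulr.
    by rewrite eq_sym (negPf cj) subrr !mulr0.
  + have -> : j = lo k by apply: val_inj; rewrite /= jk.
    by rewrite rle //= vlo; lia.
- move=> w Lw wlt; rewrite rle //= vlo dvdzE abszN -dvdzE.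
  have m0 : (m.+1)%:Z != 0 :> int by [].
  (* A nonzero remainder would be, up to sign, the entry at [lo k] of a vector of [L] that beats the
     minimal one. *)
  apply/dvdz_mod0P/eqP; apply: contraT => rem0.
  have rem_ge := modz_ge0 (w 0 (lo k)) m0.
  have rem_lt : (w 0%R (lo k) %% m.+1 < m.+1)%Z by rewrite ltz_pmod.
  have wE := divz_eq (w 0 (lo k)) m.+1.
  set q := (w 0%R (lo k) %/ m.+1)%Z in wE.
  set x := (w 0%R (lo k) %% m.+1)%Z in wE rem0 rem_ge rem_lt.
  have : P (`|x|.-1)%N.
    apply/asboolP; exists (- (w + q *: v)); split.
    - by apply: lattice_opp => //; apply: lattice_add => //; apply: lattice_scale.
    - by move=> j jk; rewrite !mxE wlt // vlt // mulr0 addr0 oppr0.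
    - rewrite !mxE vlo {1}wE; lia.
  by move/mmin; lia.
Qed.

(** Integral elimination from the left: divisibility lets a multiple of [r k] clear the entry at
    [lo k]. Once the first [n] entries vanish, the zero coordinate sum kills the last. *)
Lemma hessenberg_span (r : 'I_n -> 'rV[int]_n.+1) :
  (forall k, [/\ L (r k), r k 0 (lo k) < 0,
      forall j : 'I_n.+1, (j < k)%N -> r k 0 j = 0,
      forall j, j != hi k -> r k 0 j <= 0
    & forall v, L v -> (forall j : 'I_n.+1, (j < k)%N -> v 0 j = 0) ->
        (r k 0%R (lo k) %| v 0%R (lo k))%Z]) ->
  forall v, L v -> exists c : 'I_n -> int, v = \sum_k c k *: r k.
Proof.
move=> rP; have [[L0 LB] Lsum _] := hL.
suff H m : forall v, L v -> (forall j : 'I_n.+1, (j < n - m)%N -> v 0 j = 0) ->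
    exists c : 'I_n -> int, v = \sum_k c k *: r k.
  by move=> v Lv; apply: (H n) => // j; rewrite subnn.
elim: m => [|m IH] v Lv vlt.
  exists (fun _ => 0); rewrite big1 => [|k _]; last by rewrite scale0r.
  have v0 j : j != ord_max -> v 0 j = 0.
    by move=> jm; apply: vlt; move: jm (ltn_ord j); rewrite -val_eqE /=; lia.
  apply/rowP => j; rewrite mxE; case: (eqVneq j ord_max) => [->|/v0//].
  by rewrite -[RHS](Lsum _ Lv) (bigD1 ord_max) //= big1 ?addr0.
case: (leqP n m) => nm.
  by apply: IH => // j jn; apply: vlt; lia.
have kn : (n - m.+1 < n)%N by lia.
pose k := Ordinal kn.
have [Lr rlo rlt rle rdvd] := rP k.
have /dvdzP[q vq] := rdvd _ Lv vlt.
have [|j jm|c vc] := IH (v - q *: r k).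
- exact: LB Lv (lattice_scale L0 LB _ Lr).
- case: (ltngtP j k) => jk.
  + by rewrite !mxE vlt // rlt // mulr0 subr0.
  + by move: jm jk => /=; lia.
  + have -> : j = lo k by apply: val_inj; rewrite /= jk.
    by rewrite !mxE vq subrr.
exists (fun i => c i + (i == k)%:R * q).
under eq_bigr do rewrite scalerDl.
rewrite big_split /= -vc [X in _ + X](bigD1 k) //= eqxx mul1r big1 ?addr0 ?subrK //.
by move=> i /negPf ->; rewrite mul0r scale0r.
Qed.

(** Sum the entries at [hi k] over the set T of all [k] with [s k <= 0]. For [l] in T the row [r l]
    contributes a nonnegative sum, as its omitted entries are nonpositive and its total is zero; for
    [l] outside T a nonpositive one. Multiplied by [s l], both become nonpositive, whereas a
    nonempty T makes the whole sum positive. *)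
Lemma hessenberg_combination_gt0 (r : 'I_n -> 'rV[int]_n.+1) (s : 'I_n -> int) :
  (forall k j, j != hi k -> r k 0 j <= 0) -> (forall k, \sum_j r k 0 j = 0) ->
  (forall k, 0 < (\sum_l s l *: r l) 0 (hi k)) -> forall k, 0 < s k.
Proof.
move=> rle rsum u_gt0 k0; rewrite ltNge; apply/negP => sk0.
have : 0 < \sum_(k | s k <= 0) (\sum_l s l *: r l) 0 (hi k).
  rewrite (bigD1 k0) //=; apply: ltr_pwDl; first exact: u_gt0.
  by apply: sumr_ge0 => k _; apply: ltW.
under eq_bigr do rewrite summxE.
rewrite exchange_big /= ltNge => /negP[].
apply: sumr_le0 => l _; under eq_bigr do rewrite mxE.
rewrite -mulr_sumr; case: (lerP (s l) 0) => sl.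
  apply: mulr_le0_ge0 => //.
  suff : \sum_(j | j != hi l) r l 0 j <=
      \sum_(k | (s k <= 0) && (k != l)) r l 0 (hi k).
    move=> H; rewrite (bigD1 l) //=.
    by have := rsum l; rewrite (bigD1 (hi l)) //=; lra.
  rewrite [leLHS]big_mkcond big_ord_recl /= [leRHS]big_mkcond /=.
  rewrite -[leRHS]add0r; apply: lerD; first exact: rle.
  apply: ler_sum => k _; rewrite (inj_eq (@lift_inj _ ord0)).
  case: (eqVneq k l) => kl /=; first by rewrite andbF.
  rewrite andbT; case: ifP => // _.
  by apply: rle; rewrite (inj_eq (@lift_inj _ ord0)).
apply: mulr_ge0_le0; first exact: ltW.
apply: sumr_le0 => k sk; apply: rle; rewrite (inj_eq (@lift_inj _ ord0)).
by apply: contraTneq sk => ->; rewrite -ltNge.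
Qed.

Lemma initial_data_exists : exists Sigma Q, initial_data L Sigma Q.
Proof.
have [D D0 LD] := multiple_of_An_in_lattice.
have [[L0 LB] Lsum _] := hL.
have [r rP] := choice hessenberg_row.
pose u := \sum_j D%:Z *: (e j - e ord0).
have Lu : L u by apply: lattice_sum => // j _.
have [s us] := hessenberg_span rP Lu.
have uhi k : u 0 (hi k) = D.
  rewrite summxE (bigD1 (hi k)) //= big1 => [|j /negPf jk].
    by rewrite addr0 !mxE !eqxx /= !subr0 mulr1.
  by rewrite !mxE !eqxx /= eq_sym jk subr0 mulr0.
have s0 k : 0 < s k.
  apply: (@hessenberg_combination_gt0 r s) => // [l|l|l].
  - by case: (rP l).
  - by apply: Lsum; case: (rP l).
  - by rewrite -us uhi; lia.
(* Row 0 is [- u], so the expansion of [u] in the [r k] says that [(1, s)] is a left kernel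
   vector. *)
pose M : 'M[int]_n.+1 :=
  \matrix_(i, j) if unlift ord0 i is Some k then r k 0 j else - u 0 j.
have M0 j : M ord0 j = - u 0 j by rewrite mxE unlift_none.
have Mhi k j : M (hi k) j = r k 0 j by rewrite mxE liftK.
have Mle i j : i != j -> M i j <= 0.
  case: (unliftP ord0 i) => [k ->|->].
    by rewrite eq_sym Mhi => kj; case: (rP k) => _ _ _ ->.
  case: (unliftP ord0 j) => [k ->|->]; last by rewrite eqxx.
  by rewrite M0 uhi; lia.
have LM i : L (row i M).
  case: (unliftP ord0 i) => [k ->|->].
    have -> : row (hi k) M = r k by apply/rowP => j; rewrite mxE Mhi.
    by case: (rP k).
  have -> : row ord0 M = - u by apply/rowP => j; rewrite mxE M0 mxE.
  exact: lattice_opp.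
have Msum i : \sum_j M i j = 0.
  by apply: etrans (Lsum _ (LM i)); apply: eq_bigr => j _; rewrite [RHS]mxE.
pose A : 'M[nat]_n.+1 := \matrix_(i, j) if i == j then 0%N else `|M i j|%N.
have AE i j : i != j -> (A i j)%:R = - (M i j)%:~R :> rat.
  move=> ij; rewrite mxE (negPf ij).
  by rewrite pmulrn -intrN; congr (_%:~R); have := Mle _ _ ij; lia.
pose sigma : 'rV[int]_n.+1 :=
  \row_i if unlift ord0 i is Some k then s k else 1.
pose Sigma : 'rV[nat]_n.+1 :=
  \row_i if unlift ord0 i is Some k then `|s k|%N else 1%N.
have SigmaE : natr_row Sigma = map_mx intr sigma.
  apply/rowP => j; rewrite !mxE; case: unlift => // k.
  by rewrite pmulrn gtz0_abs.
exists Sigma, (map_mx intr M); split.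
- exists A; split.
    (* Vertex 0 has an edge of weight [D] to every other vertex, and [hi k] has one to its
       predecessor [lo k]; descending leads back to 0. *)
    have A0 j : connect [rel a b | A a b != 0%N] ord0 j.
      case: (unliftP ord0 j) => [k ->|->//]; apply: connect1 => /=.
      rewrite mxE (negPf (neq_lift _ _)) absz_eq0 M0 uhi oppr_eq0.
      by rewrite -lt0n in D0 *; lia.
    suff Ai0 m (i : 'I_n.+1) : (i <= m)%N -> connect [rel a b | A a b != 0%N] i ord0.
      by move=> i j; apply: connect_trans (Ai0 i i (leqnn i)) (A0 j).
    elim: m i => [|m IH] i im.
      by have -> : i = ord0 by apply: val_inj => /=; lia.
    case: (unliftP ord0 i) im => [k ->|-> //] im.
    apply: connect_trans (IH (lo k) _); last by move: im; rewrite /= /bump /=; lia.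
    apply: connect1; rewrite /= mxE Mhi.
    have -> : hi k == lo k = false by rewrite -val_eqE /= /bump /=; lia.
    by rewrite absz_eq0; case: (rP k) => _ /lt_eqF ->.
  apply/esym/laplacian_eq => [i|i j ij]; last first.
    by rewrite [in RHS]mxE -AE // [LHS]mxE.
  under eq_bigr do rewrite mxE; by rewrite -rmorph_sum Msum.
- apply/seteqP; split => [v [c ->]|_ [v Lv <-]].
    exists (c *m M); last by rewrite map_mxM.
    rewrite mulmx_sum_row; apply: lattice_sum => // i _.
    by apply: lattice_scale.
  have [c ->] := hessenberg_span rP Lv.
  exists (\row_i if unlift ord0 i is Some k then c k else 0).
  rewrite -map_mxM; congr map_mx.
  apply/rowP => j; rewrite mxE big_ord_recl !mxE unlift_none mul0r add0r.
  by rewrite summxE; apply: eq_bigr => k _; rewrite !mxE liftK.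
- rewrite SigmaE -map_mxM.
  suff -> : sigma *m M = 0 by apply/rowP => j; rewrite !mxE.
  apply/rowP => j; rewrite mxE big_ord_recl M0 us !mxE unlift_none mul1r summxE.
  apply/eqP; rewrite addrC subr_eq0; apply/eqP; apply: eq_bigr => k _.
  by rewrite !mxE liftK.
- split=> [i|]; last by rewrite big_ord_recl mxE unlift_none gcd1n.
  by rewrite mxE; case: unlift => // k; rewrite absz_gt0 gt_eqF.
- by rewrite mxE unlift_none.
Qed.
End InitialData.

(** * Deformation steps *)

Lemma trmulE n (Q : 'M[rat]_n.+1) y k :
  trmul Q y 0 k = \sum_a (y 0 a)%:R * Q a k.
Proof. by rewrite mxE; apply: eq_bigr => a _; rewrite mxE. Qed.

Lemma trmulD n (Q Q' : 'M[rat]_n.+1) y : trmul (Q + Q') y = trmul Q y + trmul Q' y.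
Proof. exact: mulmxDr. Qed.

Lemma trmulZ n c (Q : 'M[rat]_n.+1) y : trmul (c *: Q) y = c *: trmul Q y.
Proof. by rewrite /trmul -scalemxAr. Qed.

Lemma trmulDZ n (Q Q' : 'M[rat]_n.+1) c y k :
  trmul (Q + c *: Q') y 0 k = trmul Q y 0 k + c * trmul Q' y 0 k.
Proof. by rewrite trmulD trmulZ mxE [X in _ + X]mxE. Qed.

Lemma scaling_gt0 n (Q : 'M[rat]_n.+1) : 0 < scaling Q.
Proof. by rewrite /scaling; case: xgetP => // c _ []. Qed.

(** For [Q = 0] any scaling works. Otherwise the candidates are positive integer multiples of
    [1 / q], with [q] the absolute value of a nonzero entry, so a least one exists and the default
    of [xget] is not taken. *)
Lemma scaling_integral n (Q : 'M[rat]_n.+1) : integral_mx (scaling Q *: Q).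
Proof.
have [Q0|/matrix0Pn [i [j qN0]]] := eqVneq Q 0.
  by move=> i j; rewrite Q0 !mxE mulr0 rpred0.
rewrite /scaling; case: xgetP => [c _ []//|none]; exfalso.
set q := `|Q i j|; have q0 : 0 < q by rewrite normr_gt0.
have mulq_nat c : 0 < c -> integral_mx (c *: Q) -> exists k, c = k.+1%:R / q.
  move=> c0 /(_ i j); rewrite mxE => cQ.
  have : c * q \is a Num.nat.
    by rewrite /q -{1}(gtr0_norm c0) -normrM natr_norm_int.
  case/natrP => -[|k] ck.
    by move/eqP: ck; rewrite mulf_eq0 !gt_eqF.
  by exists k; rewrite -ck mulfK // gt_eqF.
pose P k := `[< integral_mx ((k.+1%:R / q) *: Q) >].
have exP : exists k, P k.
  have [d [N [d0 dN]]] := clear_denominators Q.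
  have dQ : integral_mx (d%:R *: Q).
    by move=> a b; rewrite dN mxE intr_int.
  have [|k dk] := mulq_nat _ _ dQ; first by rewrite ltr0n.
  by exists k; apply/asboolP; rewrite -dk.
case: (ex_minnP exP) => m /asboolP mQ mmin.
apply: (none (m.+1%:R / q)); split=> //; first by rewrite divr_gt0 ?ltr0n.
move=> c c0 cQ; have [k ck] := mulq_nat c c0 cQ.
rewrite ck ler_pM2r ?invr_gt0 // ler_nat ltnS; apply: mmin.
by apply/asboolP; rewrite -ck.
Qed.

(** * Laplacians with weights divided by [Sigma] *)

Section Weighted.
Variables (n : nat) (Sigma : 'rV[nat]_n.+1).
Hypothesis Sigma_gt0 : forall a, (0 < Sigma 0%R a)%N.
Implicit Types (e : 'M[rat]_n.+1) (y : 'rV[nat]_n.+1).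

Definition ratio y a : rat := (y 0 a)%:R / (Sigma 0 a)%:R.

(** Dividing by [Sigma 0 a] puts [Sigma] in the left kernel whenever [e] is symmetric; sums of
    multiples of [two_edges] with distinct endpoints have this form. *)
Definition weighted_laplacian e : 'M[rat]_n.+1 :=
  laplacian (\matrix_(a, b) (e a b / (Sigma 0 a)%:R)).

Definition edge_pair (i j : 'I_n.+1) : 'M[rat]_n.+1 := delta_mx i j + delta_mx j i.

Lemma SigmaR_gt0 a : 0 < (Sigma 0 a)%:R :> rat.
Proof. by rewrite ltr0n. Qed.

Lemma SigmaR_neq0 a : (Sigma 0 a)%:R != 0 :> rat.
Proof. by rewrite gt_eqF // SigmaR_gt0. Qed.

Lemma ratio_ge0 y a : 0 <= ratio y a.
Proof. by rewrite /ratio divr_ge0. Qed.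

Lemma ratio_le1 y a : box Sigma y -> ratio y a <= 1.
Proof. by move=> /(_ a) ya; rewrite ler_pdivrMr ?SigmaR_gt0 // mul1r ler_nat. Qed.

Lemma weighted_laplacianE e a b : a != b ->
  weighted_laplacian e a b = - (e a b / (Sigma 0 a)%:R).
Proof. by move=> /negPf ab; rewrite laplacianE ab sub0r mxE. Qed.

Lemma weighted_laplacianD e e' :
  weighted_laplacian (e + e') = weighted_laplacian e + weighted_laplacian e'.
Proof.
apply: laplacian_eq => [i|i j ij].
  by under eq_bigr do rewrite mxE; rewrite big_split /= !laplacian_sum addr0.
by rewrite [in RHS]mxE !weighted_laplacianE // !mxE -opprD opprK mulrDl.
Qed.

Lemma weighted_laplacianZ c e :
  weighted_laplacian (c *: e) = c *: weighted_laplacian e.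
Proof.
apply: laplacian_eq => [i|i j ij].
  by under eq_bigr do rewrite mxE; rewrite -mulr_sumr !laplacian_sum mulr0.
by rewrite [in RHS]mxE !weighted_laplacianE // !mxE mulrN opprK mulrA.
Qed.

Lemma two_edgesE i j : i != j ->
  two_edges Sigma i j = weighted_laplacian (edge_pair i j).
Proof.
move=> ij; congr laplacian; apply/matrixP => a b; rewrite !mxE.
case: eqVneq => [->|ai] /=.
  rewrite (negPf ij) /= addr0.
  by case: eqVneq => _; rewrite ?mul1r ?mul0r.
rewrite add0r; case: eqVneq => [->|aj] /=; last by rewrite mul0r.
by case: eqVneq => _; rewrite ?mul1r ?mul0r.
Qed.

(** In terms of the ratios [y / Sigma], the transpose acts as the Laplacian of the undirected graph
    with weights [e]. *)
Lemma trmul_weighted e y k : (forall a b, e a b = e b a) ->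
  trmul (weighted_laplacian e) y 0 k = \sum_b e k b * (ratio y k - ratio y b).
Proof.
move=> esym; rewrite trmulE.
under eq_bigr do rewrite laplacianE mulrBr mxE.
rewrite sumrB (bigD1 k) //= eqxx [X in _ + X - _]big1 ?addr0; last first.
  by move=> a /negPf ->; rewrite mulr0.
rewrite mulr_sumr -sumrB; apply: eq_bigr => b _.
rewrite mxE (esym b k) /ratio; ring.
Qed.

Lemma edge_pair_sym i j a b : edge_pair i j a b = edge_pair i j b a.
Proof. by rewrite !mxE [LHS]addrC; congr (_ + _); rewrite andbC. Qed.

Lemma trmul_edge i j y k : i != j ->
  trmul (two_edges Sigma i j) y 0 k =
  ((k == i)%:R - (k == j)%:R) * (ratio y i - ratio y j).
Proof.
move=> ij; rewrite two_edgesE // trmul_weighted; last exact: edge_pair_sym.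
under eq_bigr do rewrite !mxE mulrDl.
rewrite big_split /= (bigD1 j) //= [X in _ + _ + X](bigD1 i) //=.
rewrite !big1 ?addr0 => [|a /negPf ->|a /negPf ->]; rewrite ?andbF ?mul0r //.
rewrite !eqxx !andbT.
case: (eqVneq k i) => [->|_]; last case: (eqVneq k j) => [->|_].
- by rewrite (negPf ij) /=; ring.
- by rewrite /=; ring.
- by rewrite /=; ring.
Qed.

Lemma trmul_weighted_Sigma e : (forall a b, e a b = e b a) ->
  trmul (weighted_laplacian e) Sigma = 0.
Proof.
move=> esym; apply/rowP => k; rewrite trmul_weighted // big1 ?mxE // => b _.
by rewrite /ratio !divff ?SigmaR_neq0 // subrr mulr0.
Qed.

(** Column [i] alone contributes both summands, in rows [i] and [j]. This turns the [delta] part of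
    admissibility into a bound on edge weights. *)
Lemma mxnorm1_two_edges i j : i != j ->
  (Sigma 0 i)%:R^-1 + (Sigma 0 j)%:R^-1 <= mxnorm1 (two_edges Sigma i j).
Proof.
move=> ij; rewrite /mxnorm1.
have Se a : 0 <= (Sigma 0 a)%:R^-1 :> rat by rewrite invr_ge0 ler0n.
apply: (@le_trans _ _ (\sum_a `|two_edges Sigma i j a i|)); last first.
  exact: (le_bigmax _ (fun b => \sum_a `|two_edges Sigma i j a b|) i).
rewrite two_edgesE // (bigD1 i) //= (bigD1 j) ?[j == i]eq_sym //= addrA.
apply: ler_wpDr; first exact: sumr_ge0.
have ji : j != i by rewrite eq_sym.
have Eji : edge_pair i j j i = 1 by rewrite !mxE !eqxx (negPf ij) andbF add0r.
have Eij : edge_pair i j i j = 1 by rewrite edge_pair_sym.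
have E0 a b : 0 <= edge_pair i j a b by rewrite !mxE addr_ge0 // ler0n.
have Eii : edge_pair i j i i = 0 by rewrite !mxE eqxx (negPf ij) andbF addr0.
rewrite (weighted_laplacianE _ (_ : j != i)) 1?eq_sym // Eji mul1r normrN.
rewrite (ger0_norm (Se j)) lerD2r.
rewrite /weighted_laplacian laplacianE eqxx mxE Eii mul0r subr0.
rewrite (bigD1 j) //= mxE Eij mul1r.
have ge0 : 0 <= \sum_(b < n.+1 | b != j)
    (\matrix_(a, b) (edge_pair i j a b / (Sigma 0 a)%:R)) i b :> rat.
  by apply: sumr_ge0 => b _; rewrite mxE mulr_ge0.
by rewrite ger0_norm ?addr_ge0 // lerDl.
Qed.

(** The condition is one-sided, on entry [a] only. A step can only choose an [(i, j)] not yet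
    settled, and a positive parameter settles both orders. *)
Definition settled (Q : 'M[rat]_n.+1) a b : Prop :=
  forall y, box Sigma y -> ratio y a != ratio y b -> trmul Q y 0 a != 0.

Variables (R : realType) (delta : R).

(** The entry changes from [a] to [a + eps * b]. It could vanish only for [eps = - (a / b)], which
    for nonzero [a] forces opposite signs, the case excluded by the strict bound on [eps]. *)
Lemma deform_step_neq0 Q eps Q' y k : deform_step delta Sigma Q eps Q' ->
  box Sigma y -> trmul Q y 0 k != 0 -> trmul Q' y 0 k != 0.
Proof.
case=> x [i [j [_ _ rij [eps0 [eps_lt _]] ->]]] yb Qy.
have ij : i != j by apply: contraNneq rij => ->.
rewrite trmulDZ.
have [kij|kij] := boolP (k \in [:: i; j]); last first.
  move: kij; rewrite trmul_edge // !inE negb_or => /andP[/negPf -> /negPf ->].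
  by rewrite subrr mul0r mulr0 addr0.
move: (eps_lt y k yb kij) Qy.
set a := trmul Q y 0 k; set b := trmul (two_edges Sigma i j) y 0 k.
move=> eps_ba a0; apply/eqP => ab0.
have aE : a = - (eps * b) by apply/eqP; rewrite -addr_eq0 ab0.
have b0 : b != 0 by apply: contraNneq a0; rewrite aE => ->; rewrite mulr0 oppr0.
have epsE : - (a / b) = eps by rewrite aE mulNr opprK mulfK.
have eps_gt0 : 0 < eps.
  by rewrite lt_def eps0 andbT; apply: contraNneq a0; rewrite aE => ->;
     rewrite mul0r oppr0.
have : b * a < 0.
  by rewrite aE mulrN oppr_lt0 mulrCA mulr_gt0 // -expr2 exprn_even_gt0.
by move/eps_ba; rewrite epsE ltxx.
Qed.

(** The vector [x] of the step shows that [(i, j)] was not settled. Afterwards an entry that was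
    zero is plus or minus [eps] times a nonzero difference of ratios, and nonzero entries stay
    nonzero. *)
Lemma deform_stepP Q eps Q' : deform_step delta Sigma Q eps Q' ->
  exists i j, [/\ i != j, 0 <= eps, Q' = Q + eps *: two_edges Sigma i j,
    ~ settled Q i j /\ (0 < eps -> settled Q' i j /\ settled Q' j i)
    & ratr eps < delta /
    (ratr (mxnorm1 (two_edges Sigma i j)) * n.+1%:R * (\prod_s Sigma 0%R s)%:R)].
Proof.
move=> step; case: (step) => x [i [j [[xb _ _] Qx rij [eps0 [_ epsd]] Q'E]]].
have ij : i != j by apply: contraNneq rij => ->.
exists i, j; split => //; split.
  move=> /(_ x xb); rewrite eq_sym => /(_ rij).
  move/negP; apply; move/eqP: Qx.
  by rewrite trmulZ mxE mulf_eq0 gt_eqF // scaling_gt0.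
move=> eps_gt0.
have key k y : k \in [:: i; j] -> box Sigma y -> ratio y i != ratio y j ->
    trmul Q' y 0 k != 0.
  move=> kij yb rij'; have [Qy|] := eqVneq (trmul Q y 0 k) 0; last first.
    exact: deform_step_neq0 step yb.
  rewrite Q'E trmulDZ Qy add0r trmul_edge //.
  apply: mulf_neq0; first by rewrite gt_eqF.
  apply: mulf_neq0; last by rewrite subr_eq0.
  move: kij; rewrite !inE => /orP[] /eqP ->.
    by rewrite eqxx (negPf ij).
  by rewrite eqxx [j == i]eq_sym (negPf ij).
split=> y yb rr; first by apply: key => //; rewrite inE eqxx.
by apply: key => //; rewrite ?inE ?eqxx ?orbT // eq_sym.
Qed.

End Weighted.

(** * Termination, invariant and progress of runs *)

Lemma eventually_not_of_increase (f : nat -> nat) (P : nat -> Prop) B :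
  (forall r, (f r <= B)%N) -> (forall r, (f r <= f r.+1)%N) ->
  (forall r, P r -> (f r < f r.+1)%N) ->
  exists N, forall r, (N <= r)%N -> ~ P r.
Proof.
move=> fB fle flt.
suff H m : forall r0, (B - f r0 <= m)%N ->
    exists N, forall r, (N <= r)%N -> ~ P r by exact: (H B 0%N (leq_subr _ _)).
have fmono r s : (r <= s)%N -> (f r <= f s)%N.
  by move/subnK <-; elim: (s - r)%N => // k /leq_trans; apply.
elim: m => [|m IH] r0 Br0.
  exists r0 => r /fmono r0r /flt; have := fB r.+1; lia.
have [none|] := pselect (forall r, (r0 <= r)%N -> ~ P r); first by exists r0.
move=> /existsNP [r] /not_implyP [/fmono r0r /contrapT /flt Pr].
by apply: (IH r.+1); have := fB r.+1; lia.
Qed.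

Section Run.
Variables (n : nat) (Sigma : 'rV[nat]_n.+1) (R : realType) (delta : R).
Hypothesis Sigma_gt0 : forall a, (0 < Sigma 0%R a)%N.

Lemma settled_step Q eps Q' a b : deform_step delta Sigma Q eps Q' ->
  settled Sigma Q a b -> settled Sigma Q' a b.
Proof.
move=> step Qab y yb rab; exact: deform_step_neq0 step yb (Qab y yb rab).
Qed.

(** The number of settled ordered pairs never drops, and it rises at each step with nonzero
    parameter. *)
Lemma deform_run_terminates Q : deform_terminates delta Sigma Q.
Proof.
move=> Qs eps _ step.
pose S r := [pred p : 'I_n.+1 * 'I_n.+1 | `[< settled Sigma (Qs r) p.1 p.2 >]].
have inS r p : (p \in S r) = `[< settled Sigma (Qs r) p.1 p.2 >] by [].
have Ssub r : S r \subset S r.+1.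
  apply/fintype.subsetP => -[a b]; rewrite !inS => /asboolW Sab; apply: asboolT.
  exact: settled_step (step r) Sab.
have [|r|r er|N NP] := @eventually_not_of_increase (fun r => #|S r|)
    (fun r => eps r <> 0) #|{: 'I_n.+1 * 'I_n.+1}|.
- by move=> r; apply: max_card.
- exact: subset_leq_card (Ssub r).
- apply: proper_card; rewrite properE Ssub /=.
  have [i [j [ij eps0 _ [Qij Q'ij] _]]] := deform_stepP (step r).
  have [Q'ij1 _] : settled Sigma (Qs r.+1) i j /\ settled Sigma (Qs r.+1) j i.
    by apply: Q'ij; rewrite lt_def eps0 andbT; apply/eqP.
  apply/negP => /fintype.subsetP /(_ (i, j)); rewrite !inS => H; apply: Qij.
  by apply: asboolW; apply: H; apply: asboolT.
- by exists N => r /NP /contrapT.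
Qed.

Definition weight_bound : R := n.+1%:R * (\prod_s Sigma 0%R s)%:R.

Lemma weight_bound_gt0 : 0 < weight_bound.
Proof. by rewrite mulr_gt0 ?ltr0n // prodn_gt0. Qed.

(** The matrix [e] collects the parameters. Nonzero weights belong to settled pairs and a positive
    step uses an unsettled one, so each weight is set only once and the bound from a single step
    suffices. *)
Lemma deform_reach_inv Q Q' : 0 < delta -> deform_reach delta Sigma Q Q' ->
  exists e : 'M[rat]_n.+1,
    [/\ [/\ forall a b, e a b = e b a, forall a, e a a = 0
          & forall a b, 0 <= e a b],
        forall a b, ratr (e a b * ((Sigma 0 a)%:R^-1 + (Sigma 0 b)%:R^-1)) *
                    weight_bound <= delta,
        Q' = Q + weighted_laplacian Sigma e
      & forall a b, e a b != 0 -> settled Sigma Q' a b].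
Proof.
move=> d0; elim=> {Q'} [|Q' eps Q'' _ [e [[esym e0 ege] eb Q'E es]] step].
  exists 0; split.
  - by split=> *; rewrite !mxE.
  - by move=> a b; rewrite mxE mul0r rmorph0 mul0r ltW.
  - by rewrite -(scale0r 0) weighted_laplacianZ scale0r addr0.
  - by move=> a b; rewrite mxE eqxx.
have [i [j [ij eps0 Q''E [Qij Q'ij] epsd]]] := deform_stepP step.
have [eps00|epsN0] := eqVneq eps 0.
  exists e; split=> // [|a b eab]; first by rewrite Q''E eps00 scale0r addr0.
  by apply: settled_step step _; apply: es.
have eps_gt0 : 0 < eps by rewrite lt_def epsN0.
have [sij sji] := Q'ij eps_gt0.
have eij : e i j = 0 by apply/eqP; apply: contra_notT Qij; apply: es.
have eji : e j i = 0 by rewrite esym.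
have epE a b : edge_pair i j a b = 0 \/ (a = i /\ b = j) \/ (a = j /\ b = i).
  have [/andP[/eqP -> /eqP ->]|abij] := boolP ((a == i) && (b == j)).
    by right; left.
  have [/andP[/eqP -> /eqP ->]|abji] := boolP ((a == j) && (b == i)).
    by right; right.
  by left; rewrite !mxE (negPf abij) (negPf abji) addr0.
have ep1 : edge_pair i j i j = 1.
  by rewrite !mxE !eqxx (negPf ij) addr0.
have ep2 : edge_pair i j j i = 1 by rewrite edge_pair_sym.
have ebound : ratr (eps * ((Sigma 0 i)%:R^-1 + (Sigma 0 j)%:R^-1)) *
                    weight_bound <= delta.
  have N1 := mxnorm1_two_edges Sigma ij.
  have N0 : 0 < mxnorm1 (two_edges Sigma i j).
    by apply: lt_le_trans N1; rewrite addr_gt0 // invr_gt0 ltr0n.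
  move: epsd; rewrite -mulrA -/weight_bound.
  have W0 : 0 < ratr (mxnorm1 (two_edges Sigma i j)) * weight_bound.
    by rewrite mulr_gt0 ?ltr0q ?weight_bound_gt0.
  rewrite (ltr_pdivlMr _ _ W0) mulrA => /ltW.
  apply: le_trans; rewrite ler_pM2r ?weight_bound_gt0 // -rmorphM ler_rat.
  by rewrite ler_pM2l.
exists (e + eps *: edge_pair i j).
have eE a b : (e + eps *: edge_pair i j) a b = e a b + eps * edge_pair i j a b.
  by rewrite mxE [X in _ + X]mxE.
split.
- split=> [a b|a|a b]; rewrite !eE.
  + by rewrite esym edge_pair_sym.
  + rewrite e0 add0r; case: (epE a a) => [->|[[-> /eqP]|[-> /eqP]]].
    * by rewrite mulr0.
    * by rewrite (negPf ij).
    * by rewrite eq_sym (negPf ij).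
  + by case: (epE a b) => [->|[[-> ->]|[-> ->]]];
      rewrite ?ep1 ?ep2 ?mulr0 ?mulr1 ?addr0 ?addr_ge0.
- move=> a b; rewrite eE; case: (epE a b) => [->|[[-> ->]|[-> ->]]].
  + by rewrite mulr0 addr0.
  + by rewrite ep1 eij mulr1 add0r.
  + by rewrite ep2 eji mulr1 add0r addrC.
- by rewrite weighted_laplacianD weighted_laplacianZ Q''E Q'E two_edgesE //
             -[LHS]addrA.
- move=> a b; rewrite eE; case: (epE a b) => [->|[[-> ->]|[-> ->]]].
  + by rewrite mulr0 addr0 => /es eab; exact: settled_step step eab.
  + by [].
  + by [].
Qed.

(** Scaling makes the entry a nonzero integer. The bound serves to find a positive admissible
    parameter. *)
Lemma trmul_scaling_ge1 (Q : 'M[rat]_n.+1) y k : trmul Q y 0 k != 0 ->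
  (scaling Q)^-1 <= `|trmul Q y 0 k|.
Proof.
move=> Qy0; have sc0 := scaling_gt0 Q.
rewrite -(ler_pM2l sc0) divff ?gt_eqF // -{1}(gtr0_norm sc0) -normrM.
apply: norm_intr_ge1; last by rewrite mulf_neq0 // gt_eqF.
have -> : scaling Q * trmul Q y 0 k = trmul (scaling Q *: Q) y 0 k.
  by rewrite trmulZ [RHS]mxE.
rewrite trmulE; apply: rpred_sum => a _; apply: rpredM; last exact: scaling_integral.
exact: natr_int.
Qed.

(** If all ratios agree, then [x] is [x 0 0] times [Sigma] because [Sigma 0 0 = 1]; and [x 0 0] is 0
    or 1, giving the two excluded vectors. *)
Lemma open_box_ratio (x : 'rV[nat]_n.+1) i : Sigma 0 0 = 1%N ->
  open_box Sigma x -> exists j, ratio Sigma x j != ratio Sigma x i.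
Proof.
move=> S0 [xb x0 xS]; apply: contrapT => /forallNP H.
have {}H j : ratio Sigma x j = ratio Sigma x 0.
  by move/negP: (H j) (H 0) => /negPn/eqP -> /negP/negPn/eqP ->.
have xj j : (x 0 j)%:R = (x 0 0)%:R * (Sigma 0 j)%:R :> rat.
  have := H j; rewrite /ratio S0 divr1 => <-.
  by rewrite divfK // SigmaR_neq0.
have := xb 0; rewrite S0; case E : (x 0 0) => [|[|//]] _.
- apply: x0; apply/rowP => j; have := xj j.
  by rewrite E mul0r mxE => /eqP; rewrite pnatr_eq0 => /eqP.
- apply: xS; apply/rowP => j; have := xj j.
  by rewrite E mul1r => /eqP; rewrite eqr_nat => /eqP.
Qed.

Lemma deform_run_progresses Q : Sigma 0 0 = 1%N -> 0 < delta ->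
  deform_progress delta Sigma Q.
Proof.
move=> S0 d0 {}Q _ /existsNP [x] /not_implyP [xb] /existsNP [i] /negP.
rewrite negbK => /eqP xi.
have [j rij] := open_box_ratio i S0 xb.
have ij : i != j by apply: contraNneq rij => ->.
set bd := delta / (ratr (mxnorm1 (two_edges Sigma i j)) * n.+1%:R *
                   (\prod_s Sigma 0%R s)%:R).
have bd0 : 0 < bd.
  have N0 : 0 < mxnorm1 (two_edges Sigma i j).
    apply: lt_le_trans (mxnorm1_two_edges Sigma ij).
    by rewrite addr_gt0 // invr_gt0 ltr0n.
  by rewrite divr_gt0 // -mulrA mulr_gt0 ?weight_bound_gt0 ?ltr0q.
(* On the box the entries of [trmul (two_edges Sigma i j) y] are at most 1 in absolute value, so
   each negative quotient has absolute value at least [(scaling Q)^-1]. *)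
have : 0 < Num.min bd (ratr (scaling Q)^-1).
  by rewrite lt_min bd0 ltr0q invr_gt0 scaling_gt0.
move=> /rat_in_itvoo [eps]; rewrite in_itv /= lt_min ltr0q ltr_rat.
move=> /andP[eps0 /andP[epsd epsl]].
exists eps, (Q + eps *: two_edges Sigma i j); split=> //.
exists x, i, j; split=> //; split; first exact: ltW.
split=> // y k yb kij; set a := trmul Q y 0 k; set b := trmul _ y 0 k => ba.
have b_le1 : `|b| <= 1.
  have := ratio_ge0 Sigma y i; have := ratio_ge0 Sigma y j.
  have := ratio_le1 Sigma_gt0 i yb; have := ratio_le1 Sigma_gt0 j yb.
  rewrite /b trmul_edge //; move: kij; rewrite !inE ler_norml.
  case: (eqVneq k i) => [->|_] /=; first by rewrite (negPf ij) /=; nra.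
  by move=> /eqP ->; rewrite eqxx /=; nra.
have a0 : a != 0 by apply: contraTneq ba => ->; rewrite mulr0 ltxx.
have b0 : b != 0 by apply: contraTneq ba => ->; rewrite mul0r ltxx.
apply: (lt_le_trans epsl); apply: le_trans (trmul_scaling_ge1 a0) _.
have -> : - (a / b) = `|a| / `|b|.
  rewrite -normf_div ler0_norm // -[a / b](@mulfK _ (b ^+ 2)) ?expf_neq0 //.
  have -> : a / b * b ^+ 2 = b * a by rewrite expr2; field.
  by rewrite mulr_le0_ge0 ?invr_ge0 ?sqr_ge0 // ltW.
by rewrite ler_pdivlMr ?normr_gt0 // ler_piMr.
Qed.

End Run.

(** * Chip firing and lattice ideals *)

Section IdealGen.
Variables (A : comNzRingType) (S : set A).

Lemma ideal_gen0 : ideal_gen S 0.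
Proof. by exists 0%N, (fun=> 0), (fun=> 0); split=> [[]|]; rewrite ?big_ord0. Qed.

Lemma ideal_gen_in p : S p -> ideal_gen S p.
Proof.
move=> Sp; exists 1%N, (fun=> 1), (fun=> p); split=> //.
by rewrite big_ord_recl big_ord0 mul1r addr0.
Qed.

Lemma ideal_genM c p : ideal_gen S p -> ideal_gen S (c * p).
Proof.
case=> k [a [g [Sg ->]]]; exists k, (fun i => c * a i), g; split=> //.
by rewrite mulr_sumr; apply: eq_bigr => i _; rewrite mulrA.
Qed.

Lemma ideal_genD p q : ideal_gen S p -> ideal_gen S q -> ideal_gen S (p + q).
Proof.
case=> k [a [g [Sg ->]]] [k' [a' [g' [Sg' ->]]]].
exists (k + k')%N, (fun i => match split i with inl j => a j | inr j => a' j end),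
  (fun i => match split i with inl j => g j | inr j => g' j end).
split=> [i|]; first by case: split.
rewrite big_split_ord; congr (_ + _); apply: eq_bigr => i _.
  by rewrite (unsplitK (inl i)).
by rewrite (unsplitK (inr i)).
Qed.

End IdealGen.

Lemma ideal_gen_sub (A : comNzRingType) (S T : set A) :
  S `<=` ideal_gen T -> ideal_gen S `<=` ideal_gen T.
Proof.
move=> ST _ [k [a [g [Sg ->]]]]; apply: (big_ind (ideal_gen T)).
- exact: ideal_gen0.
- exact: ideal_genD.
- by move=> i _; apply/ideal_genM/ST.
Qed.

Lemma pos_partE n (u : 'rV[int]_n.+1) i :
  pos_part u i = if 0 <= u 0 i then `|u 0%R i|%N else 0%N.
Proof. by rewrite mnmE; case: leP => // u0; case: ltgtP u0. Qed.

Lemma exp_diff_pos_part n (u : 'rV[int]_n.+1) :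
  exp_diff (pos_part u) (pos_part (- u)) = u.
Proof.
apply/rowP => i; rewrite !mxE !pos_partE mxE.
by move: (u 0 i) => x; case: (lerP 0 x); case: (lerP 0 (- x)); lia.
Qed.

Section ChipFiring.
Variables (K : fieldType) (n : nat) (Sigma : 'rV[nat]_n.+1) (M : 'M[int]_n.+1).
Hypothesis Sigma_gt0 : forall a, (0 < Sigma 0%R a)%N.
Hypothesis M_le0 : forall i j, i != j -> M i j <= 0.
Hypothesis SigmaM : map_mx Posz Sigma *m M = 0.

Let fire (x : 'rV[nat]_n.+1) : 'rV[int]_n.+1 := map_mx Posz x *m M.

Lemma fireE x i : fire x 0 i = \sum_k (x 0 k)%:Z * M k i.
Proof. by rewrite mxE; apply: eq_bigr => k _; rewrite mxE. Qed.

Lemma fire_le (x y : 'rV[nat]_n.+1) i :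
  (forall k, (x 0%R k <= y 0%R k)%N) -> x 0 i = y 0 i -> fire y 0 i <= fire x 0 i.
Proof.
move=> xy xyi; rewrite !fireE; apply: ler_sum => k _.
have [->|ki] := eqVneq k i; first by rewrite xyi.
by apply: ler_wnM2r; [exact: M_le0 | rewrite lez_nat].
Qed.

(* Firing the largest part of [z] lying in the box, backwards from [b], is
   legal: at [i] it adds either at least as much as [z], which leads to
   [a i >= 0], or at least as much as [Sigma], which adds nothing. *)
Lemma chip_firing_ideal (S : set {mpoly K[n.+1]}) :
  (forall x, box Sigma x -> S (binomial_of K (fire x))) ->
  forall (z : 'rV[nat]_n.+1) (a b : 'X_{1..n.+1}),
    (forall i, (a i)%:Z = (b i)%:Z + fire z 0 i) ->
    ideal_gen S ('X_[a] - 'X_[b]).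
Proof.
move=> Sx z; move: {2}(\sum_k z 0%R k)%N (leqnn (\sum_k z 0%R k)) => m.
elim: m z => [|m IH] z zm a b ab.
  have z0 k : z 0 k = 0%N.
    by apply/eqP; rewrite -leqn0 (leq_trans _ zm) // (bigD1 k) //= leq_addr.
  suff -> : a = b by rewrite subrr; apply: ideal_gen0.
  apply/mnmP => i; have := ab i; rewrite fireE big1 => [|k _]; first by lia.
  by rewrite z0 mul0r.
pose x : 'rV[nat]_n.+1 := \row_k minn (z 0 k) (Sigma 0 k).
have xE k : x 0 k = minn (z 0 k) (Sigma 0 k) by rewrite mxE.
have xz k : (x 0%R k <= z 0%R k)%N by rewrite xE geq_minl.
have xb : box Sigma x by move=> k; rewrite xE geq_minr.
pose u := fire x.
have legal i : 0 <= (b i)%:Z + u 0 i.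
  have [zi|zi] := leqP (z 0 i) (Sigma 0 i).
    have : fire z 0 i <= u 0 i by apply: fire_le => //; rewrite xE; lia.
    by have := ab i; lia.
  have : fire Sigma 0 i <= u 0 i by apply: fire_le => //; rewrite xE; lia.
  by rewrite /fire SigmaM mxE; lia.
pose b' : 'X_{1..n.+1} := [multinom absz ((b i)%:Z + u 0 i)%R | i < n.+1].
(* Multiplying [binomial_of K u] by this monomial gives ['X_[b'] - 'X_[b]]; legality makes the
   truncated subtraction exact. *)
pose c : 'X_{1..n.+1} := [multinom (b i - pos_part (- u) i)%N | i < n.+1].
have b'E i : b' i = absz ((b i)%:Z + u 0 i)%R by rewrite mnmE.
have cE i : c i = (b i - pos_part (- u) i)%N by rewrite mnmE.
have uN i : (- u) 0 i = - u 0 i by rewrite mxE.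
have -> : 'X_[a] - 'X_[b] = ('X_[a] - 'X_[b']) + 'X_[c] * binomial_of K u.
  rewrite /binomial_of mulrBr -!mpolyXD.
  have -> : (c + pos_part u)%MM = b'.
    by apply/mnmP => i; rewrite mnmDE ?b'E cE !pos_partE uN; have := legal i;
      move: (u 0 i) => w; case: (lerP 0 w); case: (lerP 0 (- w)); lia.
  have -> : (c + pos_part (- u))%MM = b.
    by apply/mnmP => i; rewrite mnmDE ?b'E cE !pos_partE uN; have := legal i;
      move: (u 0 i) => w; case: (lerP 0 w); case: (lerP 0 (- w)); lia.
  by rewrite addrA subrK.
apply: ideal_genD; last by apply/ideal_genM/ideal_gen_in/Sx.
(* For [z = 0] the total does not drop, but then [b' = b] and the zero vector meets the induction
   bound. *)
case: (eqVneq z 0) => [z0|zN0].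
  apply: (IH 0); first by rewrite big1 // => k _; rewrite mxE.
  move=> i; rewrite ab fireE big1 => [|k _]; last by rewrite z0 mxE mul0r.
  rewrite fireE big1 => [|k _]; last by rewrite mxE mul0r.
  rewrite b'E /u fireE big1 => [|k _]; first lia.
  by rewrite xE z0 mxE min0n mul0r.
apply: (IH (\row_k (z 0%R k - x 0%R k)%N)).
  (* Where [z] is nonzero so is [x], because [Sigma] is positive; hence the total of [z - x] is
     smaller. *)
  have [k zk] : exists k, z 0 k != 0%N.
    by case/matrix0Pn: zN0 => i [k]; rewrite ord1 => zk; exists k.
  suff : (\sum_i (\row_k (z 0%R k - x 0%R k)) 0%R i < \sum_i z 0%R i)%N by lia.
  rewrite (bigD1 k) //= [ltnRHS](bigD1 k) //= -addSn leq_add //.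
    by rewrite mxE xE; have := Sigma_gt0 k; lia.
  by apply: leq_sum => i _; rewrite mxE leq_subr.
move=> i; rewrite ab b'E.
have -> : fire (\row_k (z 0%R k - x 0%R k)%N) 0 i = fire z 0 i - u 0 i.
  rewrite /u !fireE -sumrB; apply: eq_bigr => k _.
  by rewrite mxE -mulrBl subzn.
by have := legal i; lia.
Qed.

(** For the harder inclusion, a multiple of [Sigma], which fires to zero, is added to make the
    coefficients nonnegative. *)
Lemma lattice_ideal_fire (S : set {mpoly K[n.+1]}) (L : set 'rV[int]_n.+1) :
  (forall w, L w <-> exists c : 'rV[int]_n.+1, w = c *m M) ->
  S = [set binomial_of K (fire x) | x in box Sigma] ->
  ideal_gen S = lattice_ideal K L.
Proof.
move=> LM SE; apply/seteqP; split; apply: ideal_gen_sub.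
  rewrite SE => _ [x _ <-]; apply: ideal_gen_in.
  exists (pos_part (fire x)), (pos_part (- fire x)); split=> //.
  by rewrite exp_diff_pos_part; apply/LM; exists (map_mx Posz x).
move=> _ [u [v [/LM [c uv] ->]]].
pose N := (\sum_k `|c 0%R k|)%N.
pose z : 'rV[nat]_n.+1 := \row_k absz (c 0 k + N%:Z * (Sigma 0 k)%:Z)%R.
have zE : map_mx Posz z = c + N%:Z *: map_mx Posz Sigma.
  apply/rowP => k; rewrite !mxE.
  have cN : (`|c 0%R k| <= N)%N by rewrite /N (bigD1 k) //= leq_addr.
  have add_absz (p q : int) (m : nat) :
    (`|p| <= m)%N -> m%:Z <= q -> (absz (p + q)%R)%:Z = p + q by lia.
  by apply: add_absz cN _; rewrite ler_peMr // lez_nat Sigma_gt0.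
apply: (@chip_firing_ideal _ _ z) => [x xb|i]; first by rewrite SE; exists x.
have -> : fire z = c *m M.
  by rewrite /fire zE mulmxDl -scalemxAl SigmaM scaler0 addr0.
by rewrite -uv !mxE; lia.
Qed.

End ChipFiring.

(** Passing to the integral matrix [scaling Q *: Q] keeps signs and kernel, so chip firing applies;
    the floor only reads its entries as integers. *)
Lemma ideal_gen_groebner K n (Sigma : 'rV[nat]_n.+1) (Q : 'M[rat]_n.+1) :
  (forall a, (0 < Sigma 0%R a)%N) -> (forall i j, i != j -> Q i j <= 0) ->
  trmul Q Sigma = 0 ->
  ideal_gen (groebner_set K Sigma Q) =
  lattice_ideal K (integral_multiple (scaling Q) (row_lattice Q)).
Proof.
move=> S0 Qle SQ; have sc0 := scaling_gt0 Q.
pose M : 'M[int]_n.+1 := \matrix_(i, j) Num.floor ((scaling Q *: Q) i j).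
have ME : map_mx intr M = scaling Q *: Q.
  by apply/matrixP => i j; rewrite 2!mxE floorK // scaling_integral.
have fireQ x : map_mx intr (map_mx Posz x *m M) = trmul (scaling Q *: Q) x.
  rewrite map_mxM /= ME /trmul; congr (_ *m _).
  by apply/rowP => k; rewrite !mxE.
apply: (@lattice_ideal_fire _ _ Sigma M) => //.
- move=> i j ij; rewrite -(ler_int rat).
  have := congr1 (fun A : 'M[rat]_n.+1 => A i j) ME; rewrite /= mxE => ->.
  by rewrite mxE pmulr_rle0 // Qle.
- apply: map_intr_inj; rewrite fireQ trmulZ SQ scaler0.
  by apply/rowP => k; rewrite !mxE.
- move=> w; split=> [[_ [c ->] wE]|[c ->]].
    by exists c; apply: map_intr_inj; rewrite wE map_mxM /= ME scalemxAr.
  exists (map_mx intr c *m Q); first by exists c.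
  by rewrite map_mxM /= ME scalemxAr.
- apply/seteqP; split=> [_ [u [x xb ux] <-]|_ [x xb <-]].
    by exists x => //; congr binomial_of; apply: map_intr_inj; rewrite fireQ ux.
  by exists (map_mx Posz x *m M) => //; exists x => //; rewrite fireQ.
Qed.

Lemma generic_of_stops K n (Sigma : 'rV[nat]_n.+1) (Q : 'M[rat]_n.+1) L :
  trmul Q Sigma = 0 -> stops Sigma Q ->
  ideal_gen (groebner_set K Sigma Q) = lattice_ideal K L ->
  generic_lattice_ideal K L.
Proof.
move=> SQ stopQ; rewrite /generic_lattice_ideal => <-.
pose E := [set u : 'rV[int]_n.+1 | exists2 x, open_box Sigma x &
             map_mx intr u = trmul (scaling Q *: Q) x].
exists [set (pos_part u, pos_part (- u)) | u in E]; split.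
  move=> _ [u [x xb ux] <-] i; rewrite exp_diff_pos_part.
  by rewrite -(intr_eq0 rat); have := stopQ x xb i; rewrite -ux mxE.
apply/seteqP; split; apply: ideal_gen_sub.
  move=> _ [u [x xb ux] <-].
  have binom0 : u = 0 -> ideal_gen
      [set 'X_[m.1] - 'X_[m.2] | m in [set (pos_part u, pos_part (- u)) | u in E]]
      (binomial_of K u).
    by move=> ->; rewrite /binomial_of oppr0 subrr; apply: ideal_gen0.
  have u0 : trmul (scaling Q *: Q) x = 0 -> u = 0.
    move=> ux0; apply/rowP => k; rewrite mxE.
    have := congr1 (fun v : 'rV[rat]_n.+1 => v 0 k) ux.
    by rewrite /= ux0 !mxE => /eqP; rewrite intr_eq0 => /eqP.
  case: (eqVneq x 0) => [x0|/eqP x0].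
    apply/binom0/u0; rewrite x0; apply/rowP => k; rewrite trmulE mxE big1 // => a _.
    by rewrite mxE mul0r.
  case: (eqVneq x Sigma) => [xS|/eqP xS].
    by apply/binom0/u0; rewrite xS trmulZ SQ scaler0.
  apply: ideal_gen_in; exists (pos_part u, pos_part (- u)) => //.
  by exists u => //; exists x.
move=> _ [_ [u [x [xb x0 xS] ux] <-] <-]; apply: ideal_gen_in.
by exists u => //; exists x.
Qed.

(** * Distance of lattices *)

Section SpectralNorm.
Variable R : realType.

(** Cauchy-Schwarz with weights [|b i|], from the nonnegativity of [|b i| |b j| (|v i| - |v j|)^2]
    summed over all [i], [j]. *)
Lemma sum_sqr_le_weighted (I : finType) (v b : I -> R) :
  (\sum_i v i * b i) ^+ 2 <= (\sum_i `|b i|) * \sum_i `|b i| * v i ^+ 2.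
Proof.
set S1 := \sum_i `|b i|; set S2 := \sum_i `|b i| * v i ^+ 2.
have S12 : S1 * S2 = \sum_i \sum_j `|b i| * `|b j| * v j ^+ 2.
  rewrite mulr_suml; apply: eq_bigr => i _; rewrite mulr_sumr.
  by apply: eq_bigr => j _; rewrite mulrA.
have S21 : S1 * S2 = \sum_i \sum_j `|b i| * `|b j| * v i ^+ 2.
  rewrite S12 exchange_big /=; apply: eq_bigr => i _; apply: eq_bigr => j _.
  by rewrite [`|b j| * _]mulrC.
suff : 2 * (\sum_i v i * b i) ^+ 2 <= S1 * S2 + S1 * S2 by lra.
rewrite {1}S12 S21 -big_split expr2 mulr_suml mulr_sumr /=.
apply: ler_sum => i _; rewrite mulr_sumr mulr_sumr -big_split /=.
apply: ler_sum => j _.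
rewrite -mulrDr; have : 0 <= `|b i| * `|b j| * (`|v i| - `|v j|) ^+ 2.
  by apply: mulr_ge0; [exact: mulr_ge0 | exact: sqr_ge0].
rewrite sqrrB !real_normK ?num_real // => H.
have := ler_norm ((v i * b i) * (v j * b j)); rewrite !normrM; lra.
Qed.

Lemma l2norm_ge0 k (v : 'rV[R]_k) : 0 <= l2norm v.
Proof. exact: sqrtr_ge0. Qed.

Lemma l2norm_sqr k (v : 'rV[R]_k) : l2norm v ^+ 2 = \sum_j v 0 j ^+ 2.
Proof. by rewrite sqr_sqrtr // sumr_ge0 // => j _; apply: sqr_ge0. Qed.

(** Weighted Cauchy-Schwarz and the column bound control the square of each entry of [v *m B];
    exchanging the sums then uses the row bound. *)
Lemma schur_test m k (B : 'M[R]_(m, k)) C (v : 'rV[R]_m) : 0 <= C ->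
  (forall i, \sum_j `|B i j| <= C) -> (forall j, \sum_i `|B i j| <= C) ->
  l2norm (v *m B) <= C * l2norm v.
Proof.
move=> C0 Brow Bcol.
rewrite -ler_sqr ?nnegrE ?mulr_ge0 ?l2norm_ge0 // exprMn !l2norm_sqr.
apply: (@le_trans _ _ (\sum_j C * \sum_i `|B i j| * v 0 i ^+ 2)).
  apply: ler_sum => j _; rewrite mxE.
  apply: (le_trans (sum_sqr_le_weighted _ _)); apply: ler_wpM2r; last exact: Bcol.
  by apply: sumr_ge0 => i _; rewrite mulr_ge0 ?sqr_ge0.
rewrite -mulr_sumr expr2 -mulrA ler_wpM2l // exchange_big mulr_sumr /=.
apply: ler_sum => i _; rewrite -mulr_suml ler_wpM2r ?sqr_ge0 //.
Qed.

Lemma l2norm_mulmx_ub m k (B : 'M[R]_(m, k)) C : 0 <= C ->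
  (forall i, \sum_j `|B i j| <= C) -> (forall j, \sum_i `|B i j| <= C) ->
  ubound [set l2norm (v *m B) | v in [set v : 'rV[R]_m | l2norm v <= 1]] C.
Proof.
move=> C0 Brow Bcol _ [v /= v1 <-].
by apply: (le_trans (schur_test v C0 Brow Bcol)); rewrite ler_piMr.
Qed.

Lemma mxnorm2_le m k (B : 'M[R]_(m, k)) C : 0 <= C ->
  (forall i, \sum_j `|B i j| <= C) -> (forall j, \sum_i `|B i j| <= C) ->
  mxnorm2 B <= C.
Proof.
move=> C0 Brow Bcol; apply: ge_sup; last exact: l2norm_mulmx_ub.
exists (l2norm (0 *m B)); exists 0 => //=.
by rewrite /l2norm big1 ?sqrtr0 // => j _; rewrite mxE expr0n.
Qed.

(** The unit vector [delta_mx 0 i] maps to row [i], whose norm dominates its entries. The supremum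
    needs a bounded set, and the sum of all absolute entries is a bound. *)
Lemma entry_le_mxnorm2 m k (B : 'M[R]_(m, k)) i j : `|B i j| <= mxnorm2 B.
Proof.
pose C := \sum_i \sum_j `|B i j|.
have ge0 i' : 0 <= \sum_j `|B i' j| by apply: sumr_ge0.
have ub : has_ubound
    [set l2norm (v *m B) | v in [set v : 'rV[R]_m | l2norm v <= 1]].
  exists C; apply: l2norm_mulmx_ub => [|i'|j'].
  - exact: sumr_ge0.
  - by rewrite /C (bigD1 i') //= lerDl sumr_ge0.
  - apply: ler_sum => i' _; rewrite (bigD1 j') //= lerDl sumr_ge0 //.
apply: (@le_trans _ _ (l2norm (delta_mx 0 i *m B))).
  rewrite -ler_sqr ?nnegrE ?l2norm_ge0 // l2norm_sqr -rowE.
  rewrite (bigD1 j) //= mxE real_normK ?num_real // lerDl.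
  by apply: sumr_ge0 => j' _; apply: sqr_ge0.
apply: ub_le_sup => //; exists (delta_mx 0 i) => //=.
rewrite /l2norm (bigD1 i) //= big1 => [|i' /negPf ii'].
  by rewrite mxE !eqxx expr1n addr0 sqrtr1.
by rewrite mxE ii' andbF expr0n.
Qed.

End SpectralNorm.

(** * Attainment of the minimum distance *)

Section Distance.
Variables (R : realType) (n : nat).

Lemma is_lattice_basis_row (F : fieldType) m k (L : set 'rV[F]_k)
    (B : 'M[F]_(m, k)) i : is_lattice_basis L B -> L (row i B).
Proof.
case=> _ <-; exists (delta_mx 0 i); rewrite rowE; congr (_ *m _).
by apply/rowP => j; rewrite !mxE; case: (_ && _).
Qed.

(* Up to a common denominator the difference of two bases is an integral
   matrix, so only finitely many differences have bounded norm. *)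
Lemma lattice_dist_exists (L1 L2 : set 'rV[R]_n.+1) (B1 B2 : 'M[R]_(n, n.+1))
    (d : nat) : (0 < d)%N ->
  (forall v j, L1 v -> d%:R * v 0 j \is a Num.int) ->
  (forall v j, L2 v -> d%:R * v 0 j \is a Num.int) ->
  is_lattice_basis L1 B1 -> is_lattice_basis L2 B2 ->
  exists2 x, is_lattice_dist L1 L2 x & x <= mxnorm2 (B1 - B2).
Proof.
move=> d0 L1d L2d LB1 LB2.
have dR0 : 0 < d%:R :> R by rewrite ltr0n.
(* [N] bounds [d] times each entry of a difference of norm at most [c]; the finite type [T] lists
   the numerators from [-N] to [N], shifted by [N]. *)
pose c := mxnorm2 (B1 - B2); pose N := (Num.truncn (d%:R * c)).+1.
have cN : d%:R * c <= N%:R.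
  by apply/ltW/truncnS_gt.
pose T := 'M['I_(N + N).+1]_(n, n.+1).
pose F (t : T) : 'M[R]_(n, n.+1) := \matrix_(i, j) (((t i j)%:R - N%:R) / d%:R).
pose P (t : T) := `[< exists A1 A2, [/\ is_lattice_basis L1 A1,
  is_lattice_basis L2 A2 & A1 - A2 = F t] >].
have diffP A1 A2 : is_lattice_basis L1 A1 -> is_lattice_basis L2 A2 ->
    mxnorm2 (A1 - A2) <= c -> exists2 t, P t & A1 - A2 = F t.
  move=> LA1 LA2 Ac.
  have intA i j : d%:R * (A1 - A2) i j \is a Num.int.
    have := L1d _ j (is_lattice_basis_row i LA1).
    have := L2d _ j (is_lattice_basis_row i LA2).
    by rewrite !mxE mulrBr => ? ?; apply: rpredB.
  pose f i j : int := Num.floor (d%:R * (A1 - A2) i j).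
  have fE i j : (f i j)%:~R = d%:R * (A1 - A2) i j by rewrite floorK.
  have fN i j : `|f i j| <= N%:Z.
    rewrite -(ler_int R) intr_norm fE normrM gtr0_norm //.
    apply: le_trans cN; rewrite ler_pM2l //.
    exact: le_trans (entry_le_mxnorm2 _ _ _) Ac.
  have AF : A1 - A2 = F (\matrix_(i, j) inord (absz (f i j + N%:Z)%R)).
    apply/matrixP => i j; rewrite [RHS]mxE mxE inordK; last first.
      by have := fN i j; lia.
    have -> : (absz (f i j + N%:Z)%R)%:R = (f i j + N%:Z)%:~R :> R.
      by rewrite pmulrn; congr (_%:~R); have := fN i j; lia.
    by rewrite rmorphD /= addrK fE mulrC mulKf // gt_eqF.
  by eexists; last exact: AF; apply: asboolT; exists A1, A2.
have [t0 Pt0 t0E] := diffP B1 B2 LB1 LB2 (lexx _).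
case: (@Order.TotalTheory.arg_minP _ _ _ t0 P (fun t => mxnorm2 (F t)) Pt0).
move=> t Pt tmin; exists (mxnorm2 (F t)); last by rewrite t0E tmin.
split.
  by have [A1 [A2 [LA1 LA2 AE]]] := asboolW Pt; exists A1, A2; rewrite AE.
(* A difference of norm above [c] cannot beat the minimum, since [B1 - B2] is among the
   candidates. *)
move=> A1 A2 LA1 LA2; case: (lerP (mxnorm2 (A1 - A2)) c) => Ac.
  by have [s Ps ->] := diffP A1 A2 LA1 LA2 Ac; apply: tmin.
by apply: le_trans (ltW Ac); rewrite /c t0E tmin.
Qed.

End Distance.

(** * Left kernels and bases of the row lattices *)

Section Kernel.
Variables (n : nat) (Sigma : 'rV[nat]_n.+1) (A : 'M[nat]_n.+1) (Q : 'M[rat]_n.+1).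
Hypothesis Sigma_gt0 : forall a, (0 < Sigma 0%R a)%N.
Hypothesis A_connected : strongly_connected A.
(** As an inequality it holds for the initial and the deformed matrices with the same graph [A],
    because deforming never raises off-diagonal entries. *)
Hypothesis Q_le : forall a b, a != b -> Q a b <= - (A a b)%:R.
Hypothesis SigmaQ : trmul Q Sigma = 0.

(* Maximum principle for [c / Sigma]. *)
Lemma left_kernel (c : 'rV[rat]_n.+1) : c *m Q = 0 ->
  exists m, c = m *: natr_row Sigma.
Proof.
move=> cQ; pose z a := c 0 a / (Sigma 0 a)%:R.
case: (@Order.TotalTheory.arg_maxP _ _ _ ord0 xpredT z isT) => a0 _ zmax.
exists (z a0); pose y := z a0 *: natr_row Sigma - c.
have yQ : y *m Q = 0.
  by rewrite mulmxBl -scalemxAl -/(trmul Q Sigma) SigmaQ cQ scaler0 subr0.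
have yE a : y 0 a = z a0 * (Sigma 0 a)%:R - c 0 a by rewrite !mxE.
have y_ge0 a : 0 <= y 0 a.
  by rewrite yE subr_ge0 -ler_pdivrMr ?ltr0n //; exact: zmax.
(* If [y 0 b = 0], all terms of column [b] of [y *m Q = 0] are nonpositive, hence zero: zeros of [y]
   spread backwards along edges, starting from [a0]. *)
have edge a b : A a b != 0%N -> y 0 b = 0 -> y 0 a = 0.
  have [->//|ab] := eqVneq a b; move=> Aab yb.
  have Qneg : Q a b < 0.
    by apply: le_lt_trans (Q_le ab) _; rewrite oppr_lt0 ltr0n lt0n.
  have Qab k : k != b -> Q k b <= 0.
    by move=> kb; apply: le_trans (Q_le kb) _; rewrite oppr_le0.
  have : \sum_k - (y 0 k * Q k b) = 0.
    by rewrite sumrN; have := congr1 (fun v : 'rV[rat]_n.+1 => v 0 b) yQ;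
       rewrite /= !mxE => ->; rewrite oppr0.
  move/eqP; rewrite psumr_eq0 => [/allP /(_ a)|k _]; last first.
    have [->|kb] := eqVneq k b; first by rewrite yb mul0r oppr0.
    by rewrite oppr_ge0 mulr_ge0_le0 // Qab.
  rewrite mem_index_enum => /(_ isT) /=.
  by rewrite oppr_eq0 mulf_eq0 (lt_eqF Qneg) orbF => /eqP.
have y0 a : y 0 a = 0.
  have /connectP[p pp pl] := A_connected a a0.
  elim: p a pp pl => [|b p IH] a /= => [_ <-|/andP[Aab pp] pl].
    by rewrite yE divfK ?subrr // gt_eqF // ltr0n.
  by apply: edge Aab _; apply: IH.
apply/rowP => a; have := y0 a; rewrite yE => /eqP; rewrite subr_eq0 => /eqP <-.
by rewrite !mxE.
Qed.

Hypothesis Sigma0 : Sigma 0 0 = 1%N.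

Lemma row'_mulmx (F : fieldType) (c : 'rV[F]_n.+1) (B : 'M[F]_n.+1) :
  c *m B = c 0 ord0 *: row ord0 B + col' ord0 c *m row' ord0 B.
Proof.
apply/rowP => j; rewrite mxE big_ord_recl !mxE; congr (_ + _).
by apply: eq_bigr => k _; rewrite !mxE.
Qed.

(** A relation among these rows, extended by 0, is some [m *: natr_row Sigma], whose entry 0 is [m];
    so [m = 0]. *)
Lemma row_free_row' : row_free (row' ord0 Q).
Proof.
apply: inj_row_free => v vQ.
pose c : 'rV[rat]_n.+1 := \row_i if unlift ord0 i is Some k then v 0 k else 0.
have c0 : c 0 ord0 = 0 by rewrite mxE unlift_none.
have cv : col' ord0 c = v by apply/rowP => k; rewrite !mxE liftK.
have [|m cm] := @left_kernel c; first by rewrite row'_mulmx c0 scale0r cv vQ add0r.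
have m0 : m = 0 by move: c0; rewrite cm !mxE Sigma0 mulr1.
by rewrite -cv cm m0 scale0r; apply/rowP => k; rewrite !mxE.
Qed.

(** Since [Sigma 0 0 = 1], the kernel relation writes row 0 as an integral combination of the
    others. *)
Lemma row_lattice_row' : row_lattice (row' ord0 Q) = row_lattice Q.
Proof.
apply/seteqP; split=> _ [c ->].
  exists (\row_i if unlift ord0 i is Some k then c 0 k else 0).
  rewrite row'_mulmx !mxE unlift_none scale0r add0r; congr (_ *m _).
  by apply/rowP => k; rewrite !mxE liftK.
exists (col' ord0 c - c 0 ord0 *: col' ord0 (map_mx Posz Sigma)).
have := SigmaQ; rewrite /trmul row'_mulmx mxE Sigma0 scale1r => /eqP.
rewrite addr_eq0 row'_mulmx => /eqP ->.
rewrite scalerN scalemxAl -mulNmx -mulmxDl; congr (_ *m _).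
by apply/rowP => k; rewrite !mxE rmorphB rmorphM /= addrC.
Qed.

Lemma real_lattice_basis (R : realType) :
  is_lattice_basis [set map_mx ratr v | v in row_lattice Q]
    (map_mx ratr (row' ord0 Q) : 'M[R]_(n, n.+1)).
Proof.
split; first by rewrite row_free_map row_free_row'.
have intr_ratr (c : 'rV[int]_n) :
    map_mx intr c = map_mx ratr (map_mx intr c) :> 'rV[R]_n.
  by apply/rowP => k; rewrite !mxE ratr_int.
rewrite -row_lattice_row'; apply/seteqP; split=> [_ [c ->]|_ [_ [c ->] <-]].
  by exists (map_mx intr c *m row' ord0 Q); [exists c | rewrite map_mxM intr_ratr].
by exists c; rewrite map_mxM intr_ratr.
Qed.

End Kernel.

Lemma row_lattice_denominator (R : realType) n (Q : 'M[rat]_n.+1) :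
  exists2 d, (0 < d)%N &
    forall (v : 'rV[R]_n.+1) j, [set map_mx ratr v | v in row_lattice Q] v ->
      d%:R * v 0 j \is a Num.int.
Proof.
have [d [N [d0 dN]]] := clear_denominators Q; exists d => // _ j [_ [c ->] <-].
suff -> : d%:R * map_mx ratr (map_mx intr c *m Q) 0 j = ((c *m N) 0 j)%:~R :> R.
  exact: intr_int.
have := congr1 (fun v : 'rV[rat]_n.+1 => ratr (v 0 j) : R)
  (map_mxM (intr : {rmorphism int -> rat}) c N).
rewrite -dN -scalemxAr /= [in X in _ = X]mxE rmorphM /= ratr_nat [in X in X = _]mxE.
by rewrite ratr_int => ->; rewrite [in LHS]mxE.
Qed.

(** * Norm of the total perturbation *)

Section NormBound.
Variables (n : nat) (Sigma : 'rV[nat]_n.+1) (R : realType) (delta : R).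
Hypothesis Sigma_gt0 : forall a, (0 < Sigma 0%R a)%N.
Variable e : 'M[rat]_n.+1.
Hypothesis e_sym : forall a b, e a b = e b a.
Hypothesis e_ge0 : forall a b, 0 <= e a b.
Hypothesis e_bound : forall a b,
  ratr (e a b * ((Sigma 0 a)%:R^-1 + (Sigma 0 b)%:R^-1)) *
  weight_bound Sigma R <= delta.

Let W := weighted_laplacian Sigma e.
Let P := (\prod_s Sigma 0%R s)%N.

Lemma weighted_entry_le a c : `|W a c| <=
  (if a == c then \sum_b e a b / (Sigma 0 a)%:R else 0) + e a c / (Sigma 0 a)%:R.
Proof.
have e0 b : 0 <= e a b / (Sigma 0 a)%:R by rewrite divr_ge0.
rewrite /W /weighted_laplacian laplacianE mxE.
under eq_bigr do rewrite mxE.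
apply: le_trans (ler_normB _ _) _; rewrite (ger0_norm (e0 c)) lerD2r.
by case: ifP => _; rewrite ?normr0 // ger0_norm ?sumr_ge0.
Qed.

(** [P] is at least [Sigma 0 b], and [Sigma 0 a + Sigma 0 b] is at least 2. The factor 2 is there
    because a row sum counts each weight twice, on and off the diagonal. *)
Lemma prod_bound a b :
  2 / (Sigma 0 a)%:R <= P%:R * ((Sigma 0 a)%:R^-1 + (Sigma 0 b)%:R^-1) :> rat.
Proof.
have P_ge s : (Sigma 0%R s <= P)%N.
  by rewrite /P (bigD1 s) //= leq_pmulr // prodn_gt0.
have := P_ge b; have := Sigma_gt0 a; have := Sigma_gt0 b; have := prodn_gt0.
move: (Sigma 0 a) (Sigma 0 b) P => x y p _ y0 x0 yp.
have x1 : 1 <= x%:R :> rat by rewrite ler1n.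
have y1 : 1 <= y%:R :> rat by rewrite ler1n.
have {}yp : y%:R <= p%:R :> rat by rewrite ler_nat.
have xy0 : 0 < x%:R * y%:R :> rat by nra.
rewrite -(ler_pM2r xy0).
have -> : 2 / x%:R * (x%:R * y%:R) = 2 * y%:R :> rat by field; lra.
have -> : p%:R * (x%:R^-1 + y%:R^-1) * (x%:R * y%:R) = p%:R * (x%:R + y%:R) :> rat.
  by field; lra.
nra.
Qed.

(** The factor [n.+1] in [weight_bound] pays for the number of summands. *)
Lemma sum_weights_le a :
  ratr (\sum_b e a b * ((Sigma 0 a)%:R^-1 + (Sigma 0 b)%:R^-1) * P%:R) <= delta.
Proof.
rewrite -(ler_pM2l (_ : 0 < n.+1%:R)) ?ltr0n // rmorph_sum mulr_sumr.
have -> : n.+1%:R * delta = \sum_(b < n.+1) delta.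
  by rewrite sumr_const card_ord mulr_natl.
apply: ler_sum => b _.
by apply: le_trans (e_bound a b); rewrite rmorphM /= ratr_nat mulrCA.
Qed.

Lemma weighted_row_sum a : ratr (\sum_c `|W a c|) <= delta.
Proof.
apply: le_trans (sum_weights_le a); rewrite ler_rat.
apply: le_trans (ler_sum _ (fun c _ => weighted_entry_le a c)) _.
rewrite big_split /= -big_mkcond (big_pred1 a) => [|c]; last by rewrite eq_sym.
rewrite -big_split /=; apply: ler_sum => b _.
have := prod_bound a b; have := e_ge0 a b; nra.
Qed.

(** Column [c] gets [e c b / Sigma_c] on the diagonal and, by symmetry of [e], [e c b / Sigma_b]
    from row [b], for each [b]. *)
Lemma weighted_col_sum c : ratr (\sum_a `|W a c|) <= delta.
Proof.
apply: le_trans (sum_weights_le c); rewrite ler_rat.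
apply: le_trans (ler_sum _ (fun a _ => weighted_entry_le a c)) _.
rewrite big_split /= -big_mkcond (big_pred1 c) //.
rewrite -big_split /=; apply: ler_sum => b _.
rewrite [e b c]e_sym -mulrDr ler_peMr //.
  by rewrite mulr_ge0 // addr_ge0 // invr_ge0.
by rewrite ler1n prodn_gt0.
Qed.

Lemma weighted_mxnorm2 : 0 <= delta ->
  mxnorm2 (map_mx ratr (row' ord0 W) : 'M[R]_(n, n.+1)) <= delta.
Proof.
move=> delta0.
have entry i j : `|(map_mx ratr (row' ord0 W) : 'M[R]_(n, n.+1)) i j| =
    ratr `|W (lift ord0 i) j|.
  by rewrite !mxE ratr_norm.
apply: mxnorm2_le => // [i|j]; under eq_bigr do rewrite entry.
  by rewrite -rmorph_sum weighted_row_sum.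
(* Deleting row 0 can only lower a column sum. *)
rewrite -rmorph_sum; apply: (@le_trans _ _ (ratr (\sum_a `|W a j|))); last first.
  exact: weighted_col_sum.
by rewrite ler_rat [leRHS]big_ord_recl lerDr.
Qed.

End NormBound.

Lemma image_ratr_intr (R : realType) n (L : set 'rV[int]_n.+1) :
  [set map_mx ratr v | v in [set map_mx (intr : int -> rat) v | v in L]] =
  [set map_mx intr v | v in L] :> set 'rV[R]_n.+1.
Proof.
rewrite image_comp; apply: eq_imagel => v _.
by apply/rowP => j; rewrite !mxE ratr_int.
Qed.

Theorem theorem3p4 (K : fieldType) (R : realType) (n : nat)
    (L : set 'rV[int]_n.+1) (delta : R)
    (hL : full_rank_sublattice_An L) (hdelta : 0 < delta) :
  (exists Sigma Q, initial_data L Sigma Q) /\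
  forall (Sigma : 'rV[nat]_n.+1) (Q : 'M[rat]_n.+1), initial_data L Sigma Q ->
    [/\ deform_progress delta Sigma Q,
        deform_terminates delta Sigma Q
      & forall Qgen : 'M[rat]_n.+1,
          deform_reach delta Sigma Q Qgen -> stops Sigma Qgen ->
          let lambda := scaling Qgen in
          let Lgen := row_lattice Qgen in
          [/\ ideal_gen (groebner_set K Sigma Qgen) =
                lattice_ideal K (integral_multiple lambda Lgen),
              generic_lattice_ideal K (integral_multiple lambda Lgen)
            & exists2 d : R,
                is_lattice_dist [set map_mx ratr v | v in Lgen]
                                [set map_mx intr v | v in L] d
                & d <= delta]].
Proof.
split; first exact: initial_data_exists.
move=> Sigma Q [[A [Aconn QA]] QL SQ [S_gt0 _] S0].
split; first exact: deform_run_progresses.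
  exact: deform_run_terminates.
move=> Qgen reach stop lambda Lgen.
have [e [[esym _ ege] ebound QgenE _]] := deform_reach_inv S_gt0 hdelta reach.
have Qle a b : a != b -> Q a b <= - (A a b)%:R.
  by move=> /negPf ab; rewrite QA laplacianE ab sub0r mxE.
have Qgen_le a b : a != b -> Qgen a b <= - (A a b)%:R.
  move=> ab; rewrite QgenE mxE weighted_laplacianE //.
  apply: le_trans (Qle _ _ ab); rewrite gerDl oppr_le0.
  by rewrite divr_ge0.
have SQgen : trmul Qgen Sigma = 0.
  by rewrite QgenE trmulD {1}/trmul SQ add0r trmul_weighted_Sigma.
have groebner : ideal_gen (groebner_set K Sigma Qgen) =
    lattice_ideal K (integral_multiple lambda Lgen).
  apply: ideal_gen_groebner => // a b ab.
  by apply: le_trans (Qgen_le _ _ ab) _; rewrite oppr_le0.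
split; [exact: groebner | exact: generic_of_stops groebner |].
have Bgen := real_lattice_basis S_gt0 Aconn Qgen_le SQgen S0 R.
have BL := real_lattice_basis S_gt0 Aconn Qle SQ S0 R.
have [d1 d1_gt0 d1P] := row_lattice_denominator R Qgen.
have [d2 d2_gt0 d2P] := row_lattice_denominator R Q.
rewrite -image_ratr_intr -QL.
have [|||x xdist xle] := lattice_dist_exists (d := (d1 * d2)%N) _ _ _ Bgen BL.
- by rewrite muln_gt0 d1_gt0.
- move=> v j /d1P Lv; rewrite mulnC natrM -mulrA.
  by apply: rpredM; [exact: natr_int | exact: Lv].
- move=> v j /d2P Lv; rewrite natrM -mulrA.
  by apply: rpredM; [exact: natr_int | exact: Lv].
(* The two bases differ by the total perturbation without its row 0, whose norm bounds the
   distance. *)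
exists x => //; apply: le_trans xle _.
rewrite -map_mxB.
have -> : row' ord0 Qgen - row' ord0 Q = row' ord0 (Qgen - Q).
  by apply/matrixP => i j; rewrite !mxE.
have -> : Qgen - Q = weighted_laplacian Sigma e by rewrite QgenE addrC addKr.
by apply: weighted_mxnorm2 => //; exact: ltW.
Qed.
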